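(* Let $d$ be a positive integer and let $\mathcal{F}:\mathcal{P}(\mathbb{S}^{d-1})\to\mathbb{R}^{d\times d}$ be such that there is a constant $L_{\mathcal{F}}\ge 0$ with $\|\mathcal{F}[\varrho]-\mathcal{F}[\widetilde\varrho]\|_{\mathrm{op}}\le L_{\mathcal{F}}W_1(\varrho,\widetilde\varrho)$ for all $\varrho,\widetilde\varrho\in\mathcal{P}(\mathbb{S}^{d-1})$. Set $C_{\mathcal{F}}:=\sup_{\varrho}\|\mathcal{F}[\varrho]\|_{\mathrm{op}}<\infty$ and $b(x,\varrho):=(I_d-xx^{\top})\mathcal{F}[\varrho]x$. For each $n\ge1$, let $\rho_n(0)=\frac1n\sum_{k=1}^n\delta_{x_{k,0}}$ be an empirical initial distribution, with $x_{k,0}\in\mathbb{S}^{d-1}$ (the points may depend on $n$), and let $\rho_n(t)=\frac1n\sum_{k=1}^n\delta_{x_k(t)}$ be the empirical measure associated with the solution of the finite-particle system $$\dot{x}_k(t)=b(x_k(t),\rho_n(t)),\qquad x_k(0)=x_{k,0},\qquad k=1,\dots,n.$$ Let $\rho(t)$ be the (weak) solution of the mean-field equation $\partial_t\rho+\operatorname{div}_{\mathbb{S}^{d-1}}(b(\cdot,\rho)\rho)=0$ with initial condition $\rho(0)\in\mathcal{P}(\mathbb{S}^{d-1})$. Then, for every $t\ge0$, $$W_1(\rho_n(t),\rho(t))\le e^{(3C_{\mathcal{F}}+L_{\mathcal{F}})t}\,W_1(\rho_n(0),\rho(0)).$$ Hence, as $n\to\infty$, whenever $W_1(\rho_n(0),\rho(0))\to0$,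 we have $\sup_{0\le t\le T}W_1(\rho_n(t),\rho(t))\to0$ for every finite $T>0$.
   Context: $\mathbb{S}^{d-1}$ is the unit sphere in $\mathbb{R}^d$ with the Euclidean norm $\|\cdot\|$; $\|\cdot\|_{\mathrm{op}}$ is the matrix operator norm; $\mathcal{P}(\mathbb{S}^{d-1})$ is the set of (Borel) probability measures on $\mathbb{S}^{d-1}$, equipped with the Wasserstein-1 distance $W_1$ induced by the Euclidean distance. The finiteness of $C_{\mathcal{F}}$ follows from the Lipschitz assumption and compactness of $(\mathcal{P}(\mathbb{S}^{d-1}),W_1)$. Under the Lipschitz assumption both the particle system and the mean-field equation have unique global solutions (the former in $C^1([0,\infty);(\mathbb{S}^{d-1})^n)$, the latter a weak solution in $C([0,\infty);\mathcal{P}(\mathbb{S}^{d-1}))$). Weak solution: a curve $\rho\in C([0,\infty);\mathcal{P}(\mathbb{S}^{d-1}))$ (continuous for $W_1$) with the prescribed initial value such that, for every $\varphi\in C^1(\mathbb{S}^{d-1})$ and every $t\ge0$, $$\int\varphi(x)\,d\rho(t,x)-\int\varphi(x)\,d\rho(0,x)=\int_0^t\int\nabla_{\mathbb{S}^{d-1}}\varphi(x)^{\top}b(x,\rho(s))\,d\rho(s,x)\,ds,$$ where integrals in $x$ are over $\mathbb{S}^{d-1}$ and $\nabla_{\mathbb{S}^{d-1}}$ is the spherical gradient viewed as a tangent vector in $\mathbb{R}^d$. *)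

(* Defs.v *)
From HB Require Import structures.
From mathcomp Require Import all_boot all_order all_algebra.
From mathcomp Require Import all_classical all_reals all_analysis.

Set Implicit Arguments.
Unset Strict Implicit.
Unset Printing Implicit Defensive.

Import Order.TTheory GRing.Theory Num.Theory numFieldNormedType.Exports.

Local Open Scope classical_set_scope.
Local Open Scope ring_scope.

(* The norm [`|v|] of the library on matrices is the sup norm; the Euclidean
   norm has to be defined separately. It induces the same topology. *)
Definition enorm (R : realType) (m : nat) (v : 'cV[R]_m) : R :=
  Num.sqrt (\sum_(i < m) v i 0 ^+ 2).

Definition dotv (R : realType) (m : nat) (u v : 'cV[R]_m) : R :=
  \sum_(i < m) u i 0 * v i 0.

Definition opnorm (R : realType) (m : nat) (A : 'M[R]_m) : R :=
  sup [set enorm (A *m v) | v in [set v : 'cV[R]_m | enorm v <= 1]].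

(* The ambient space is 'cV[R]_d.+1, so that its dimension d.+1 is positive and
   [sphere R d] is the d-dimensional sphere. *)
Definition unit_sphere (R : realType) (d : nat) : set 'cV[R]_d.+1 :=
  [set x | enorm x = 1].

Definition sphere (R : realType) (d : nat) : Type :=
  set_type (@unit_sphere R d).

Section sphere_instances.
Context (R : realType) (d : nat).

Let pole : 'cV[R]_d.+1 := delta_mx 0 0.

Let pole_in : pole \in @unit_sphere R d.
Proof.
apply/mem_set; rewrite /unit_sphere /= /enorm big_ord_recl big1 ?addr0.
  by rewrite mxE eqxx expr1n sqrtr1.
by move=> i _; rewrite mxE /= expr0n.
Qed.

HB.instance Definition _ := Topological.copy (sphere R d)
  (set_type (@unit_sphere R d)).
HB.instance Definition _ := isPointed.Build (sphere R d) (SigSub pole_in).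
(* Borel sigma-algebra of the subspace topology *)
HB.instance Definition _ := Measurable.copy (sphere R d)
  (g_sigma_algebraType (@open (sphere R d))).

End sphere_instances.

Definition spval (R : realType) (d : nat) (x : sphere R d) : 'cV[R]_d.+1 :=
  val (x : set_type (@unit_sphere R d)).

(* The value at y = 0 is irrelevant. *)
Definition normalize (R : realType) (d : nat) (y : 'cV[R]_d.+1) : sphere R d :=
  insubd (point : sphere R d) ((enorm y)^-1 *: y).

(* Set functions carry junk values on non-measurable sets, so the marginals are
   only compared on measurable sets. *)
Definition coupling (R : realType) (d : nat)
    (mu nu : probability (sphere R d) R) :
    set (probability (sphere R d * sphere R d)%type R) :=
  [set pi | forall A, measurable A ->
    pi (A `*` setT) = mu A /\ pi (setT `*` A) = nu A].

Definition W1 (R : realType) (d : nat) (mu nu : probability (sphere R d) R)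
    : \bar R :=
  ereal_inf [set \int[pi]_z (enorm (spval z.1 - spval z.2))%:E
            | pi in coupling mu nu]%E.

Section empirical_measure.
Context (R : realType) (d n : nat) (x : 'I_n.+1 -> sphere R d).

Definition empirical (A : set (sphere R d)) : \bar R :=
  ((n.+1%:R^-1 : R)%:E * \sum_(k < n.+1) \d_(x k) A)%E.

Let invn_ge0 : 0 <= n.+1%:R^-1 :> R. Proof. by []. Qed.

Let empiricalE : empirical =
  mscale (NngNum invn_ge0)
    (msum (fun k => [the {measure set (sphere R d) -> \bar R}
                     of \d_(x (inord k))]) n.+1).
Proof.
apply/funext => A; rewrite /empirical /mscale /msum /=; congr (_ * _)%E.
by apply: eq_bigr => k _; rewrite inord_val.
Qed.

Let empirical0 : empirical set0 = 0%E.
Proof. by rewrite empiricalE measure0. Qed.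

Let empirical_ge0 A : (0 <= empirical A)%E.
Proof. by rewrite empiricalE. Qed.

Let empirical_sigma_additive : semi_sigma_additive empirical.
Proof. by rewrite empiricalE; exact: measure_semi_sigma_additive. Qed.

HB.instance Definition _ := isMeasure.Build _ _ _ empirical
  empirical0 empirical_ge0 empirical_sigma_additive.

Let empirical_setT : empirical setT = 1%E.
Proof.
rewrite /empirical (eq_bigr (fun=> 1%:E)); last by move=> k _; rewrite diracT.
by rewrite sumEFin -EFinM sumr_const card_ord mulVf// pnatr_eq0.
Qed.

HB.instance Definition _ := Measure_isProbability.Build _ _ _ empirical
  empirical_setT.

End empirical_measure.

Section dynamics.
Context (R : realType) (d : nat).
Implicit Types (F : probability (sphere R d) R -> 'M[R]_d.+1).

Definition CF F : \bar R := ereal_sup [set (opnorm (F mu))%:E | mu in setT].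

Definition bfield F (x : sphere R d) (mu : probability (sphere R d) R)
    : 'cV[R]_d.+1 :=
  (1%:M - spval x *m (spval x)^T) *m (F mu *m spval x).

(* x has derivative v at t relative to the half-line [0, +oo); one-sided at 0 *)
Definition is_derive_nonneg (x : R -> 'cV[R]_d.+1) (t : R) (v : 'cV[R]_d.+1) :=
  (fun s => (s - t)^-1 *: (x s - x t)) @ within [set s | 0 <= s] t^' --> v.

Definition particle_solution F (n : nat) (x0 : 'I_n.+1 -> sphere R d)
    (x : 'I_n.+1 -> R -> sphere R d) :=
  (forall k, x k 0 = x0 k) /\
  (forall k t, 0 <= t ->
     is_derive_nonneg (fun s => spval (x k s)) t
       (bfield F (x k t) (empirical (fun j => x j t)))).

Definition gradient (f : 'cV[R]_d.+1 -> R) (y : 'cV[R]_d.+1) : 'cV[R]_d.+1 :=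
  \col_i 'D_(delta_mx i 0) (f : 'cV[R]_d.+1 -> R^o) y.

(* Regularity and spherical gradient of phi are those of its extension
   y |-> phi (y / |y|) to the punctured space; its Euclidean gradient at a point
   of the sphere is tangent to the sphere. *)
Definition hext (phi : sphere R d -> R) (y : 'cV[R]_d.+1) : R :=
  phi (normalize y).

Definition C1_sphere (phi : sphere R d -> R) :=
  forall y : 'cV[R]_d.+1, y != 0 ->
    differentiable (hext phi : 'cV[R]_d.+1 -> R^o) y /\
    {for y, continuous (gradient (hext phi))}.

Definition sgradient (phi : sphere R d -> R) (x : sphere R d) : 'cV[R]_d.+1 :=
  gradient (hext phi) (spval x).

Definition W1_continuous (rho : R -> probability (sphere R d) R) :=
  forall t, 0 <= t ->
    (fun s => W1 (rho s) (rho t)) @ within [set s | 0 <= s] (nbhs t) --> 0%E.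

Definition weak_solution F (rho0 : probability (sphere R d) R)
    (rho : R -> probability (sphere R d) R) :=
  [/\ W1_continuous rho,
      rho 0 = rho0 &
      forall phi, C1_sphere phi -> forall t, 0 <= t ->
        \int[rho t]_x phi x - \int[rho 0]_x phi x =
        \int[lebesgue_measure]_(s in `[0, t])
          \int[rho s]_x dotv (sgradient phi x) (bfield F x (rho s))].

End dynamics.

(* Main.v *)
From HB Require Import structures.
Require Import Defs.
From mathcomp Require Import all_boot all_order all_algebra.
From mathcomp Require Import all_classical all_reals all_analysis.
From mathcomp Require Import measurable_realfun.
From mathcomp Require Import ring lra.
Import Order.TTheory GRing.Theory Num.Theory numFieldNormedType.Exports.
Local Open Scope classical_set_scope.
Local Open Scope ring_scope.
Set Implicit Arguments.
Unset Strict Implicit.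
Unset Printing Implicit Defensive.

(** The field [b(x, rho) = (1 - x x^T) F[rho] x] is the projection to the sphere
    of the linear field [F[rho] x], so along a curve [rho] the characteristics
    are [x |-> G(t) x / |G(t) x|], where [G' = F[rho] G] and [G(0) = 1]. If [psi]
    is [C^1], then so are the functions [x |-> psi (N(s) x / |N(s) x|)] with
    [N(s) = G(t) G(s)^-1]; they solve the backward transport equation, hence
    their integrals against [rho(s)] do not depend on [s], and [rho(t)] is the
    image of [rho(0)] under the characteristics. The empirical measures of the
    particle system are weak solutions too, so both curves are images of their
    initial values.

    Transport a coupling [pi] of the initial values along both families of
    characteristics, and let [D(t)] be its cost. Two characteristics driven by
    matrices [A] and [B] separate at rate at most [3 C |x - y| + |A - B|], and
    [|A - B| <= L W1 <= L D(t)]; Gronwall's inequality bounds [D(t)] by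
    [e^((3 C + L) t) D(0)], and it remains to minimize over [pi]. No triangle
    inequality for [W1] is needed. *)

(** * Euclidean and operator norms *)

(** With [F] frozen along a given curve the transport equation becomes linear, and its field is
    linear before projection. Normalization is harmless because test functions enter through their
    0-homogeneous extensions: pulling back along a characteristic is composing the extension with an
    invertible matrix, which keeps it [C^1] with an explicit gradient.

    The distance estimate yields the rate [2 C]: one [C] from [B (x - y)], another from the term
    with factor [1 - x.y = |x - y|^2 / 2]. The third [C] is the slack of the stated constant.

    Two points resist a direct Gronwall argument. The distance of two characteristics need not be
    differentiable where they meet, so [sqrt (|x - y|^2 + d^2)] is used with arbitrary [d > 0]. The
    cost [D(t)] comes with no regularity in [t], so it is controlled through a weighted supremum,
    with an exponent slightly too large that is lowered at the end.

    At time 0 only one-sided information exists. Curves are therefore constant for negative times,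
    continuity is asked on the whole line and derivatives only at positive times. *)

Section euclid.
Context (R : realType) (m : nat).
Implicit Types (u v w : 'cV[R]_m) (A B : 'M[R]_m).

Lemma dotvC u v : dotv u v = dotv v u.
Proof. by apply: eq_bigr => i _; rewrite mulrC. Qed.

Lemma dotvDl u v w : dotv (u + v) w = dotv u w + dotv v w.
Proof. by rewrite -big_split; apply: eq_bigr => i _; rewrite mxE mulrDl. Qed.

Lemma dotvZl (a : R) u v : dotv (a *: u) v = a * dotv u v.
Proof. by rewrite mulr_sumr; apply: eq_bigr => i _; rewrite mxE mulrA. Qed.

Lemma dotvNl u v : dotv (- u) v = - dotv u v.
Proof. by rewrite -scaleN1r dotvZl mulN1r. Qed.

Lemma dotvBl u v w : dotv (u - v) w = dotv u w - dotv v w.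
Proof. by rewrite dotvDl dotvNl. Qed.

Lemma dotvDr u v w : dotv w (u + v) = dotv w u + dotv w v.
Proof. by rewrite dotvC dotvDl !(dotvC w). Qed.

Lemma dotvZr (a : R) u v : dotv u (a *: v) = a * dotv u v.
Proof. by rewrite dotvC dotvZl dotvC. Qed.

Lemma dotvBr u v w : dotv w (u - v) = dotv w u - dotv w v.
Proof. by rewrite dotvC dotvBl !(dotvC w). Qed.

Lemma dotv_mx u v : u^T *m v = (dotv u v)%:M.
Proof.
apply/matrixP => i j; rewrite !ord1 !mxE eqxx mulr1n.
by apply: eq_bigr => k _; rewrite mxE.
Qed.

Lemma dotv_mulmx A u v : dotv (A *m u) v = dotv u (A^T *m v).
Proof.
have : (A *m u)^T *m v = u^T *m (A^T *m v) by rewrite trmx_mul mulmxA.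
rewrite !dotv_mx => /matrixP/(_ 0 0).
by rewrite !mxE eqxx !mulr1n.
Qed.

Lemma dotvv_ge0 u : 0 <= dotv u u.
Proof. by apply: sumr_ge0 => i _; rewrite -expr2 sqr_ge0. Qed.

Lemma dotvv u : dotv u u = enorm u ^+ 2.
Proof. by rewrite sqr_sqrtr ?sumr_ge0// => i _; rewrite sqr_ge0. Qed.

Lemma enormE u : enorm u = Num.sqrt (dotv u u).
Proof. by []. Qed.

Lemma enorm_ge0 u : 0 <= enorm u.
Proof. exact: sqrtr_ge0. Qed.

Lemma enormZ (a : R) u : enorm (a *: u) = `|a| * enorm u.
Proof. by rewrite enormE dotvZl dotvZr mulrA -expr2 sqrtrM ?sqr_ge0// sqrtr_sqr. Qed.

Lemma enormN u : enorm (- u) = enorm u.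
Proof. by rewrite -scaleN1r enormZ normrN1 mul1r. Qed.

Lemma enorm0 : enorm (0 : 'cV[R]_m) = 0.
Proof. by rewrite -(scale0r 0) enormZ normr0 mul0r. Qed.

Lemma enorm_eq0 u : (enorm u == 0) = (u == 0).
Proof.
apply/idP/eqP => [|->]; last by rewrite enorm0.
rewrite -sqrf_eq0 -dotvv /dotv psumr_eq0; last by move=> i _; rewrite -expr2 sqr_ge0.
move/allP => h; apply/matrixP => i j; rewrite ord1 mxE.
by have := h i (mem_index_enum i); rewrite -expr2 sqrf_eq0 => /eqP.
Qed.

Lemma enorm_gt0 u : (0 < enorm u) = (u != 0).
Proof. by rewrite lt_def enorm_eq0 enorm_ge0 andbT. Qed.

Lemma cauchy_schwarz u v : `|dotv u v| <= enorm u * enorm v.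
Proof.
rewrite -ler_sqr ?nnegrE ?mulr_ge0 ?enorm_ge0// exprMn -!dotvv real_normK ?num_real//.
have [->|v0] := eqVneq v 0.
  by rewrite -(scale0r 0) !dotvZr !mul0r expr0n mulr0.
have vv0 : 0 < dotv v v by rewrite dotvv exprn_gt0// enorm_gt0.
have := dotvv_ge0 (dotv v v *: u - dotv u v *: v).
rewrite dotvBl !dotvBr !dotvZl !dotvZr (dotvC v u).
set a := dotv u u; set b := dotv u v; set c := dotv v v => h.
have -> : (b ^+ 2 <= a * c) = (0 <= c * (a * c - b ^+ 2)) by rewrite pmulr_rge0// subr_ge0.
by move: h; congr (_ <= _); ring.
Qed.

Lemma ler_dotv u v : dotv u v <= enorm u * enorm v.
Proof. exact: le_trans (ler_norm _) (cauchy_schwarz _ _). Qed.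

Lemma enormD u v : enorm (u + v) <= enorm u + enorm v.
Proof.
rewrite -ler_sqr ?nnegrE ?addr_ge0 ?enorm_ge0// -dotvv dotvDl !dotvDr (dotvC v u) sqrrD -!dotvv.
have := ler_dotv u v; lra.
Qed.

Lemma enormB u v : enorm (u - v) <= enorm u + enorm v.
Proof. by rewrite -(enormN v) enormD. Qed.

Lemma coord_enorm u i : `|u i 0| <= enorm u.
Proof.
rewrite -ler_sqr ?nnegrE ?enorm_ge0// real_normK ?num_real// -dotvv /dotv (bigD1 i)//= -expr2.
by rewrite lerDl sumr_ge0// => j _; rewrite -expr2 sqr_ge0.
Qed.

Lemma enorm_sum_norm u : enorm u <= \sum_i `|u i 0|.
Proof.
have -> : u = \sum_i (u i 0) *: delta_mx i 0.
  by rewrite {1}(matrix_sum_delta u); apply: eq_bigr => i _; rewrite big_ord1.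
have sumle (s : seq 'I_m) (f : 'I_m -> 'cV[R]_m) :
    enorm (\sum_(i <- s) f i) <= \sum_(i <- s) enorm (f i).
  elim: s => [|a s ih]; first by rewrite !big_nil enorm0.
  by rewrite !big_cons (le_trans (enormD _ _))// lerD2l.
apply: le_trans (sumle _ _) _; apply: ler_sum => i _.
have -> : (\sum_i0 u i0 0 *: delta_mx i0 0 : 'cV[R]_m) i 0 = u i 0.
  rewrite summxE (bigD1 i)//= big1 ?addr0 ?mxE ?eqxx ?mulr1// => j ji.
  by rewrite !mxE eq_sym (negPf ji) mulr0.
rewrite enormZ -[leRHS]mulr1 ler_wpM2l//.
suff -> : enorm (delta_mx i 0 : 'cV[R]_m) = 1 by [].
rewrite enormE /dotv (bigD1 i)//= big1 ?addr0; last by move=> j ji; rewrite mxE (negPf ji) mul0r.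
by rewrite mxE !eqxx mulr1 sqrtr1.
Qed.

(** [sup] is informative only for a nonempty set bounded above; this crude bound by the entries
    makes [opnorm] a true supremum. *)
Lemma opnorm_ubound A :
  ubound [set enorm (A *m v) | v in [set v | enorm v <= 1]] (\sum_i \sum_j `|A i j|).
Proof.
move=> _ [v /= v1 <-]; apply: le_trans (enorm_sum_norm _) _.
apply: ler_sum => i _; rewrite mxE; apply: le_trans (ler_norm_sum _ _ _) _.
apply: ler_sum => j _; rewrite normrM -[leRHS]mulr1 ler_wpM2l//.
exact: le_trans (coord_enorm _ _) _.
Qed.

Lemma opnorm_has_sup A : has_sup [set enorm (A *m v) | v in [set v | enorm v <= 1]].
Proof.
split; last by exists (\sum_i \sum_j `|A i j|); exact: opnorm_ubound.
by exists (enorm (A *m 0)), 0 => //=; rewrite enorm0.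
Qed.

Lemma opnorm_ge0 A : 0 <= opnorm A.
Proof.
apply: le_trans (enorm_ge0 (A *m 0)) _.
by apply: ub_le_sup; [exact: (opnorm_has_sup A).2|exists 0 => //=; rewrite enorm0].
Qed.

Lemma le_opnorm A v : enorm (A *m v) <= opnorm A * enorm v.
Proof.
have [->|v0] := eqVneq v 0; first by rewrite mulmx0 enorm0 mulr0.
have nv : 0 < enorm v by rewrite enorm_gt0.
rewrite -ler_pdivrMr//.
have : enorm (A *m ((enorm v)^-1 *: v)) <= opnorm A.
  apply: ub_le_sup; [exact: (opnorm_has_sup A).2|exists ((enorm v)^-1 *: v) => //=].
  by rewrite enormZ gtr0_norm ?invr_gt0// mulVf ?gt_eqF.
by rewrite -scalemxAr enormZ gtr0_norm ?invr_gt0// mulrC.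
Qed.

Lemma opnormD A B : opnorm (A + B) <= opnorm A + opnorm B.
Proof.
apply: ge_sup; first by exists (enorm ((A + B) *m 0)), 0 => //=; rewrite enorm0.
move=> _ [v /= v1 <-]; rewrite mulmxDl (le_trans (enormD _ _))// lerD//.
- by rewrite (le_trans (le_opnorm _ _))// -[leRHS]mulr1 ler_wpM2l// opnorm_ge0.
- by rewrite (le_trans (le_opnorm _ _))// -[leRHS]mulr1 ler_wpM2l// opnorm_ge0.
Qed.

Lemma coord_opnorm A i j : `|A i j| <= opnorm A.
Proof.
have := coord_enorm (A *m delta_mx j 0) i.
rewrite -colE mxE => /le_trans; apply.
rewrite colE (le_trans (le_opnorm _ _))// -[leRHS]mulr1 ler_wpM2l ?opnorm_ge0//.
apply: le_trans (enorm_sum_norm _) _; rewrite (bigD1 j)//= big1 ?addr0 ?mxE ?eqxx ?normr1//.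
by move=> k kj; rewrite mxE (negPf kj) normr0.
Qed.

Lemma dotv_opnorm A u v : `|dotv u (A *m v)| <= opnorm A * (enorm u * enorm v).
Proof.
apply: le_trans (cauchy_schwarz _ _) _.
by rewrite mulrCA ler_wpM2l ?enorm_ge0// le_opnorm.
Qed.

Lemma dotv_sumE A u v : dotv u (A *m v) = \sum_i \sum_j A i j * (u i 0 * v j 0).
Proof.
apply: eq_bigr => i _; rewrite mxE mulr_sumr; apply: eq_bigr => j _; ring.
Qed.

End euclid.

(** * Differential inequalities and linear differential equations *)

Section is_derive_pointwise.
Context (R : realType).
Implicit Types (f g : R -> R) (x a b : R).

Lemma is_derive_add f g x a b : is_derive x 1 f a -> is_derive x 1 g b ->
  is_derive x 1 (fun y => f y + g y) (a + b).
Proof. by move=> hf hg; exact: (is_deriveD (f := f) (g := g)). Qed.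

Lemma is_derive_sub f g x a b : is_derive x 1 f a -> is_derive x 1 g b ->
  is_derive x 1 (fun y => f y - g y) (a - b).
Proof. by move=> hf hg; exact: (is_deriveB (f := f) (g := g)). Qed.

Lemma is_derive_mul f g x a b : is_derive x 1 f a -> is_derive x 1 g b ->
  is_derive x 1 (fun y => f y * g y) (a * g x + f x * b).
Proof.
move=> hf hg; apply: is_derive_eq (is_deriveM (f := f) (g := g) (x := x) (v := 1) hf hg) _.
by rewrite /GRing.scale /=; ring.
Qed.

Lemma is_derive_scale f x a c : is_derive x 1 f a ->
  is_derive x 1 (fun y => c * f y) (c * a).
Proof. by move=> hf; exact: (is_deriveZ (f := f)). Qed.

Lemma is_derive_opp f x a : is_derive x 1 f a -> is_derive x 1 (fun y => - f y) (- a).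
Proof. by move=> hf; exact: (is_deriveN (f := f)). Qed.

Lemma is_derive_chain f g x a b : is_derive (g x) 1 f a -> is_derive x 1 g b ->
  is_derive x 1 (fun y => f (g y)) (a * b).
Proof. by move=> hf hg; exact: (is_derive1_comp (f := f)). Qed.

Lemma is_derive_bigsum (I : Type) (r : seq I) (f : I -> R -> R) (df : I -> R) x :
  (forall i, is_derive x 1 (f i) (df i)) ->
  is_derive x 1 (fun y => \sum_(i <- r) f i y) (\sum_(i <- r) df i).
Proof.
move=> h; elim: r => [|i r ih].
  have -> : (fun y : R => \sum_(i <- [::]) f i y) = cst 0.
    by apply/funext => y; rewrite big_nil.
  by rewrite big_nil; exact: is_derive_cst.
have -> : (fun y => \sum_(j <- i :: r) f j y) = (fun y => f i y + \sum_(j <- r) f j y).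
  by apply/funext => y; rewrite big_cons.
by rewrite big_cons; exact: is_derive_add.
Qed.

Lemma is_derive_continuous f x a : is_derive x 1 f a -> {for x, continuous f}.
Proof. by case=> h _; apply: differentiable_continuous; exact/derivable1_diffP. Qed.

End is_derive_pointwise.

Lemma cvg_bigsum (R : realType) (T : Type) (F : set_system T) {FF : Filter F}
    (I : Type) (r : seq I) (f : I -> T -> R) (l : I -> R) :
  (forall i, f i @ F --> l i) ->
  (fun x => \sum_(i <- r) f i x) @ F --> \sum_(i <- r) l i.
Proof.
move=> h; elim: r => [|i r ih].
  have -> : (fun x : T => \sum_(i <- [::]) f i x) = cst 0.
    by apply/funext => y; rewrite big_nil.
  by rewrite big_nil; exact: cvg_cst.
have -> : (fun y => \sum_(j <- i :: r) f j y) = (fun y => f i y + \sum_(j <- r) f j y).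
  by apply/funext => y; rewrite big_cons.
by rewrite big_cons; apply: cvgD.
Qed.

Section comparison.
Context (R : realType).
Implicit Types f g df dg : R -> R.

(** The mean value theorem for [g - f]. Derivatives enter only inside the interval, because the
    curves to come may have a kink at time 0. *)
Lemma le_increment f df g dg (a b : R) : a <= b ->
  (forall x : R, a < x < b -> is_derive x 1 f (df x)) ->
  (forall x : R, a < x < b -> is_derive x 1 g (dg x)) ->
  (forall x, a < x < b -> df x <= dg x) ->
  {within `[a, b], continuous f} -> {within `[a, b], continuous g} ->
  f b - f a <= g b - g a.
Proof.
rewrite le_eqVlt => /predU1P[->|ab]; first by rewrite !subrr.
move=> hf hg hle cf cg.
have [||c] := @MVT R (fun x => g x - f x) (fun x => dg x - df x) a b ab.
- by move=> x; rewrite in_itv /= => xab; apply: is_derive_sub; [exact: hg|exact: hf].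
- by move=> x; apply: continuousB; [exact: cg|exact: cf].
rewrite in_itv /= => cab e.
have : 0 <= (dg c - df c) * (b - a) by rewrite mulr_ge0// subr_ge0 ?hle// ltW.
rewrite -e; lra.
Qed.

Lemma is_derive_expRM (C lam x : R) :
  is_derive x 1 (fun s => C * expR (lam * s)) (C * lam * expR (lam * x)).
Proof.
rewrite (_ : C * lam * _ = C * (expR (lam * x) * (lam * 1))); last by ring.
by apply: is_derive_scale; apply: is_derive_chain.
Qed.

(** Integrating the weight [expR (lam * t)] gains a factor [1 / lam]; this gain is what makes a
    Picard step contract. *)
Lemma exp_comparison f df (C lam : R) : 0 <= C -> 0 < lam ->
  continuous f -> f 0 = 0 ->
  (forall t : R, 0 < t -> is_derive t 1 f (df t)) ->
  (forall t : R, 0 < t -> `|df t| <= C * lam * expR (lam * t)) ->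
  forall t : R, 0 <= t -> `|f t| <= C * expR (lam * t).
Proof.
move=> C0 lam0 cf f0 hf hdf t t0.
pose g s := C * expR (lam * s).
have dg := is_derive_expRM C lam.
have cg : continuous g by move=> s; exact: is_derive_continuous (dg s).
have g0 : g 0 = C by rewrite /g mulr0 expR0 mulr1.
have h1 : f t - f 0 <= g t - g 0.
  apply: (le_increment (df := df) (dg := fun s => C * lam * expR (lam * s))) => //.
  - by move=> x /andP[x0 _]; exact: hf.
  - by move=> x /andP[x0 _]; apply: le_trans (ler_norm _) (hdf _ x0).
  - exact: continuous_subspaceT.
  - exact: continuous_subspaceT.
have h2 : (- f t) - (- f 0) <= g t - g 0.
  apply: (le_increment (f := fun s => - f s) (df := fun s => - df s) (dg := fun s => C * lam * expR (lam * s))) => //.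
  - by move=> x /andP[x0 _]; apply: is_derive_opp; exact: hf.
  - move=> x /andP[x0 _]; apply: le_trans (ler_norm _) _; rewrite normrN; exact: hdf.
  - by apply: continuous_subspaceT => x; apply: continuousN; exact: cf.
  - exact: continuous_subspaceT.
rewrite f0 g0 in h1 h2; rewrite -/(g t) ler_norml; lra.
Qed.

Definition prim f (t : R) : R := parameterized_integral lebesgue_measure 0 t f.

Lemma continuous_integrable f (a b : R) : continuous f ->
  (@lebesgue_measure R).-integrable `[a, b] (EFin \o f).
Proof.
move=> cf; apply: continuous_compact_integrable; first exact: segment_compact.
exact: continuous_subspaceT.
Qed.

(** The interval of integration is empty or a point, so a primitive is constant to the left of 0 and
    stays continuous on the whole line. *)
Lemma prim_le0 f t : t <= 0 -> prim f t = 0.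
Proof.
rewrite le_eqVlt => /predU1P[->|t0].
  by rewrite /prim /parameterized_integral set_itv1 Rintegral_set1.
by rewrite /prim /parameterized_integral set_itv_ge ?Rintegral_set0// -leNgt bnd_simp.
Qed.

Lemma is_derive_prim f (t : R) : continuous f -> 0 < t -> is_derive t 1 (prim f) (f t).
Proof.
move=> cf t0.
have tt1 : t < t + 1 by rewrite ltrDl.
have [d1] := continuous_FTC1_closed tt1 (continuous_integrable 0 (t + 1) cf) t0 (cf t).
by rewrite derive1E => d2; exact: (DeriveDef d1 d2).
Qed.

Lemma continuous_prim f : continuous f -> continuous (prim f).
Proof.
move=> cf t; have [t0|t0|->] := ltgtP t 0.
- rewrite /continuous_at (prim_le0 f (ltW t0)); apply: cvg_near_cst; near=> s.
  by rewrite prim_le0// ltW//; near: s; exact: lt_nbhsl.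
- exact: is_derive_continuous (is_derive_prim cf t0).
- have := @parameterized_integral_cvg_left R 0 1 f ltr01 (continuous_integrable _ _ cf).
  by rewrite -[X in _ --> X -> _](prim_le0 f (lexx 0)).
Unshelve. all: by end_near. Qed.

End comparison.

(** * Picard iteration for [M' = A M], [M(0) = 1] *)

Section linear_ode.
Context (R : realType) (n : nat) (A : R -> 'M[R]_n) (K : R).
Hypothesis Ac : forall i j, continuous (fun t => A t i j).
Hypothesis AK : forall t i j, `|A t i j| <= K.

Let step (M : R -> 'M[R]_n) (t : R) : 'M[R]_n :=
  1%:M + \matrix_(i, j) prim (fun s => (A s *m M s) i j) t.

Let Mk k := iter k step (fun=> 1%:M).

(** The sign of [K] is known only when the matrices have an entry; the absolute value of [K] in the
    weight takes care of [n = 0]. *)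
Let K0 (i : 'I_n) : 0 <= K. Proof. exact: le_trans (normr_ge0 _) (AK 0 i i). Qed.

(* With the weight [expR (- lam t)], a Picard step contracts by the factor 1/2. *)
Let lam := 2 * n%:R * `|K| + 1.
Let lam0 : 0 < lam. Proof. by rewrite ltr_wpDl// !mulr_ge0. Qed.

Let mulcont (M : R -> 'M[R]_n) : (forall i j, continuous (fun t => M t i j)) ->
  forall i j, continuous (fun t => (A t *m M t) i j).
Proof.
move=> Mc i j t.
have -> : (fun t => (A t *m M t) i j) = (fun t => \sum_k A t i k * M t k j).
  by apply/funext => s; rewrite mxE.
rewrite /continuous_at; apply: cvg_bigsum => k; apply: continuousM; [exact: Ac|exact: Mc].
Qed.

Let mulbound (t : R) (D : 'M[R]_n) (C : R) : (forall i j, `|D i j| <= C) ->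
  forall i j, `|(A t *m D) i j| <= n%:R * `|K| * C.
Proof.
move=> hD i j; rewrite mxE; apply: le_trans (ler_norm_sum _ _ _) _.
rewrite -mulrA mulr_natl -[X in _ *+ X]card_ord -sumr_const; apply: ler_sum => k _.
by rewrite normrM ler_pM// (ger0_norm (K0 i)).
Qed.

Let step_cont (M : R -> 'M[R]_n) : (forall i j, continuous (fun t => M t i j)) ->
  forall i j, continuous (fun t => step M t i j).
Proof.
move=> Mc i j.
have -> : (fun t => step M t i j) =
    (fun t => (1%:M : 'M[R]_n) i j + prim (fun s => (A s *m M s) i j) t).
  by apply/funext => t; rewrite !mxE.
move=> t; apply: continuousD; first exact: cvg_cst.
by have := continuous_prim (@mulcont M Mc i j); apply.
Qed.

Let step_derive (M : R -> 'M[R]_n) : (forall i j, continuous (fun t => M t i j)) ->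
  forall i j (t : R), 0 < t -> is_derive t 1 (fun t => step M t i j) ((A t *m M t) i j).
Proof.
move=> Mc i j t t0.
have -> : (fun t => step M t i j) =
    (fun t => (1%:M : 'M[R]_n) i j + prim (fun s => (A s *m M s) i j) t).
  by apply/funext => s; rewrite !mxE.
rewrite -[X in is_derive _ _ _ X]add0r; apply: is_derive_add.
exact: is_derive_prim (@mulcont M Mc i j) t0.
Qed.

Let step_le0 M t : t <= 0 -> step M t = 1%:M.
Proof.
move=> t0; apply/matrixP => i j; rewrite [LHS]mxE [X in _ + X]mxE.
by rewrite prim_le0// addr0.
Qed.

Let Mk_cont k i j : continuous (fun t => Mk k t i j).
Proof.
elim: k i j => [|k ih] i j; first by move=> t; exact: cvg_cst.
exact: step_cont.
Qed.

Let Mk_le0 k t : t <= 0 -> Mk k t = 1%:M.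
Proof. by case: k => [//|k] t0; exact: step_le0. Qed.

Let step_contract (M N : R -> 'M[R]_n) (C : R) : 0 <= C ->
  (forall i j, continuous (fun t => M t i j)) ->
  (forall i j, continuous (fun t => N t i j)) ->
  (forall t i j, 0 <= t -> `|M t i j - N t i j| <= C * expR (lam * t)) ->
  forall t i j, 0 <= t -> `|step M t i j - step N t i j| <= C / 2 * expR (lam * t).
Proof.
move=> C0 Mc Nc hMN t i j t0.
apply: (@exp_comparison R (fun t => step M t i j - step N t i j)
  (fun t => (A t *m M t) i j - (A t *m N t) i j) (C / 2) lam) => //.
- by rewrite divr_ge0.
- by move=> s; apply: continuousB; exact: step_cont.
- by rewrite !step_le0 ?subrr.
- by move=> s s0; apply: is_derive_sub; exact: step_derive.
- move=> s s0.
  have -> : (A s *m M s) i j - (A s *m N s) i j = (A s *m (M s - N s)) i j.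
    by rewrite mulmxBr !mxE.
  apply: le_trans (@mulbound s (M s - N s) (C * expR (lam * s)) _ i j) _.
    by move=> i' j'; rewrite !mxE; exact/hMN/ltW.
  (* What remains is [n |K| C <= C / 2 * lam], the inequality for which [lam] was chosen. *)
  rewrite !mulrA ler_wpM2r ?expR_ge0// /lam.
  lra.
Qed.

Let Mk_step k t i j : 0 <= t ->
  `|Mk k.+1 t i j - Mk k t i j| <= 2^-1 ^+ k * expR (lam * t).
Proof.
elim: k t i j => [|k ih] t i j t0.
  rewrite expr0.
  apply: (@exp_comparison R (fun t => Mk 1 t i j - Mk 0 t i j)
    (fun t => (A t *m 1%:M) i j - 0) 1 lam) => //.
  - by move=> s; apply: continuousB; exact: Mk_cont.
  - by rewrite !Mk_le0// subrr.
  - move=> s s0; apply: is_derive_sub; last exact: is_derive_cst.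
    by apply: (@step_derive (fun=> 1%:M)) => // i' j' u; exact: cvg_cst.
  - move=> s s0; rewrite subr0 mulmx1 mul1r (le_trans (AK _ _ _))//.
    apply: (@le_trans _ _ (lam * 1)); last first.
      by rewrite ler_pM2l// -expR0 ler_expR mulr_ge0// ltW.
    have n1 : 1 <= n%:R :> R by rewrite ler1n (leq_ltn_trans _ (ltn_ord i)).
    rewrite mulr1 /lam (ger0_norm (K0 i)).
    have : K <= n%:R * K by rewrite ler_peMl// (K0 i).
    have := K0 i; lra.
rewrite exprSr; apply: (@step_contract (Mk k.+1) (Mk k)) => //; rewrite exprn_ge0.
Qed.

(** Around each iterate lies an interval whose radius is the geometric tail
    [2 * 2^-k * expR (lam * t)] of the increments. For [t >= 0] these intervals are nested, so the
    supremum of their left ends lies in all of them: limit and rate of convergence come together. *)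
Let Mlim (t : R) : 'M[R]_n :=
  \matrix_(i, j) sup (range (fun k => Mk k t i j - 2 * (2^-1 ^+ k * expR (lam * t)))).

Let Mlim_bound t k i j : 0 <= t ->
  `|Mlim t i j - Mk k t i j| <= 2 * (2^-1 ^+ k * expR (lam * t)).
Proof.
move=> t0; set E := expR (lam * t); have E0 : 0 < E by exact: expR_gt0.
pose lo k := Mk k t i j - 2 * (2^-1 ^+ k * E).
pose hi k := Mk k t i j + 2 * (2^-1 ^+ k * E).
have lohi k' : lo k' <= hi k'.
  have : 0 <= 2^-1 ^+ k' * E by rewrite mulr_ge0 ?exprn_ge0// ltW.
  by rewrite /lo /hi; lra.
have stepb k' : `|Mk k'.+1 t i j - Mk k' t i j| <= 2^-1 ^+ k' * E by exact: Mk_step.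
have hlo : {homo lo : a b / (a <= b)%N >-> a <= b}.
  apply: homo_leq => [x|y x z|k']; [exact: lexx|exact: le_trans|].
  by have := stepb k'; rewrite /lo exprS ler_norml; lra.
have hhi : {homo hi : a b / (a <= b)%N >-> b <= a}.
  apply: homo_leq => [x|y x z h1 h2|k']; [exact: lexx|exact: le_trans h2 h1|].
  by have := stepb k'; rewrite /hi exprS ler_norml; lra.
have lohi2 a b : lo a <= hi b.
  apply: le_trans (hlo _ _ (leq_maxl a b)) _.
  exact: le_trans (lohi _) (hhi _ _ (leq_maxr a b)).
have hs : has_sup (range lo).
  by split; [exists (lo 0%N), 0%N|exists (hi 0%N) => _ [m _ <-]].
have -> : Mlim t i j = sup (range lo) by rewrite mxE.
have h1 : lo k <= sup (range lo) by apply: ub_le_sup; [exact: hs.2|exists k].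
have h2 : sup (range lo) <= hi k by apply: ge_sup; [exact: hs.1|move=> _ [m _ <-]].
rewrite /lo in h1; rewrite /hi in h2; rewrite ler_norml; lra.
Qed.

Let half_small (C : R) (e : R) : 0 < e -> exists k, C * 2^-1 ^+ k < e.
Proof.
move=> e0; have : (fun k => C * 2^-1 ^+ k) @ \oo --> C * 0.
  apply: cvgM; [exact: cvg_cst|apply: cvg_expr].
  by rewrite ger0_norm ?invr_ge0// invf_lt1// ltr1n.
rewrite mulr0 => /cvgrPdist_lt/(_ _ e0)[N _ h]; exists N.
by have := h N (leqnn _); rewrite sub0r normrN; apply: le_lt_trans; exact: ler_norm.
Qed.

Let Mlim_le0 t : t <= 0 -> Mlim t = 1%:M.
Proof.
move=> t0; apply/matrixP => i j; apply/eqP; rewrite -subr_eq0 -normr_le0.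
rewrite leNgt; apply/negP => h.
set E := expR (lam * t); have E0 : 0 < E by exact: expR_gt0.
pose lo k := Mk k t i j - 2 * (2^-1 ^+ k * E).
suff : Mlim t i j = (1%:M : 'M[R]_n) i j by move=> e; rewrite e subrr normr0 ltxx in h.
have lok k : lo k = (1%:M : 'M[R]_n) i j - 2 * (2^-1 ^+ k * E) by rewrite /lo Mk_le0.
rewrite [LHS]mxE -/lo.
have hs : has_sup (range lo).
  split; first by exists (lo 0%N), 0%N.
  exists ((1%:M : 'M[R]_n) i j) => _ [m _ <-]; rewrite lok gerBl.
  by rewrite !mulr_ge0 ?exprn_ge0// ltW.
apply/eqP; rewrite eq_le; apply/andP; split.
  apply: ge_sup; [exact: hs.1|move=> _ [m _ <-]]; rewrite lok gerBl.
  by rewrite !mulr_ge0 ?exprn_ge0// ltW.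
apply/ler_addgt0Pr => e e0; have [k hk] := half_small (2 * E) e0.
apply: (@le_trans _ _ (lo k + e)); first by rewrite lok; lra.
by rewrite lerD2r; apply: ub_le_sup; [exact: hs.2|exists k].
Qed.

Let Mlim_bound' t k i j :
  `|Mlim t i j - Mk k t i j| <= 2 * (2^-1 ^+ k * expR (lam * `|t|)).
Proof.
have [t0|t0] := leP 0 t; first by rewrite (ger0_norm t0); exact: Mlim_bound.
rewrite Mlim_le0 ?(ltW t0)// Mk_le0 ?(ltW t0)// subrr normr0.
by rewrite !mulr_ge0 ?exprn_ge0// expR_ge0.
Qed.

Let Mlim_cont i j : continuous (fun t => Mlim t i j).
Proof.
move=> t; apply/cvgrPdist_lt => e e0.
(* The weight at [|t| + 1] dominates the weight on the unit ball about [t], so one [k] serves all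
   nearby times. *)
have [k hk] := half_small (2 * expR (lam * (`|t| + 1))) (divr_gt0 e0 (ltr0Sn _ 2)).
have bd s : `|s| <= `|t| + 1 -> `|Mlim s i j - Mk k s i j| < e / 3.
  move=> hs; apply: le_lt_trans (Mlim_bound' s k i j) _; apply: le_lt_trans hk.
  rewrite -[leRHS]mulrA ler_pM2l// [leRHS]mulrC ler_wpM2l ?exprn_ge0//.
  by rewrite ler_expR ler_wpM2l// ltW.
have e3 : 0 < e / 3 by exact: divr_gt0.
near=> s.
have h1 : `|Mk k t i j - Mk k s i j| < e / 3.
  by near: s; move/cvgrPdist_lt: (@Mk_cont k i j t) => /(_ _ e3).
have h2 := bd t; have h3 : `|Mlim s i j - Mk k s i j| < e / 3.
  apply: bd; have : `|t - s| < 1.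
    by near: s; apply: cvgr_dist_lt; [exact: cvg_id|].
  have := ler_normB t (t - s); rewrite subKr; lra.
have := h2 ltac:(lra); move: h1 h3; rewrite !ltr_norml; lra.
Unshelve. all: by end_near. Qed.

(** For positive [t], both sides are within [2^-k * expR (lam * t)] of the iterate [Mk k.+1], for
    every [k]: the left one by the rate of convergence, the right one by contraction. *)
Let Mlim_step t i j : Mlim t i j = step Mlim t i j.
Proof.
have [t0|t0] := leP t 0; first by rewrite Mlim_le0// step_le0.
apply/eqP; rewrite -subr_eq0 -normr_le0; apply/ler_addgt0Pr => e e0; rewrite add0r.
have [k hk] := half_small (3 * expR (lam * t)) e0; apply: ltW; apply: le_lt_trans hk.
have h1 := @Mlim_bound t k.+1 i j (ltW t0).
have h2 : `|step Mlim t i j - step (Mk k) t i j| <= 2 * 2^-1 ^+ k / 2 * expR (lam * t).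
  apply: (@step_contract Mlim (Mk k) (2 * 2^-1 ^+ k)) => //; last exact: ltW.
  by move=> s i' j' s0; rewrite -[leRHS]mulrA; exact: Mlim_bound.
change (step (Mk k) t i j) with (Mk k.+1 t i j) in h2.
have E0 : 0 <= 2^-1 ^+ k * expR (lam * t) by rewrite mulr_ge0 ?exprn_ge0// expR_ge0.
have -> : 3 * expR (lam * t) * 2^-1 ^+ k = 3 * (2^-1 ^+ k * expR (lam * t)) by ring.
have e1 : 2 * 2^-1 ^+ k / 2 * expR (lam * t) = 2^-1 ^+ k * expR (lam * t) by field.
have e2 : 2 * (2^-1 ^+ k.+1 * expR (lam * t)) = 2^-1 ^+ k * expR (lam * t).
  by rewrite exprS; field.
rewrite e1 in h2; rewrite e2 in h1.
move: h1 h2; rewrite !ler_norml; lra.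
Qed.

Lemma linear_ode_exists : exists M : R -> 'M[R]_n,
  [/\ forall i j, continuous (fun t => M t i j),
      forall t, t <= 0 -> M t = 1%:M &
      forall t : R, 0 < t -> forall i j,
        is_derive t 1 (fun s => M s i j) ((A t *m M t) i j)].
Proof.
exists Mlim; split; [exact: Mlim_cont|exact: Mlim_le0|].
move=> t t0 i j.
have -> : (fun s => Mlim s i j) = (fun s => step Mlim s i j).
  by apply/funext => s; exact: Mlim_step.
exact: step_derive.
Qed.

End linear_ode.

(** * Topology of the sphere *)

Lemma cvg_mx_entries (R : realType) (m n : nat) (T : Type) (F : set_system T)
    {FF : Filter F} (f : T -> 'M[R]_(m, n)) (l : 'M[R]_(m, n)) :
  (forall i j, (fun x => f x i j) @ F --> l i j) -> f @ F --> l.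
Proof.
move=> h; apply/cvgrPdist_le => /= e e0; near=> x.
rewrite /Num.Def.normr/= mx_normrE (bigmax_le _ (ltW e0))//= => i _.
rewrite !mxE/=; move: i; near: x; apply: filter_forall => /= i.
by move/cvgrPdist_le : (h i.1 i.2) => /(_ _ e0).
Unshelve. all: by end_near. Qed.

Lemma unitmx_mul_neq0 (R : realType) (m : nat) (N : 'M[R]_m) (y : 'cV[R]_m) :
  N \in unitmx -> y != 0 -> N *m y != 0.
Proof. by move=> uN; apply: contra_neq => h; rewrite -(mulKmx uN y) h mulmx0. Qed.

Section enorm_continuity.
Context (R : realType) (m : nat).

Lemma cvg_coord (T : Type) (F : set_system T) {FF : Filter F} (p n : nat)
    (f : T -> 'M[R]_(p, n)) (l : 'M[R]_(p, n)) i j :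
  f @ F --> l -> (fun x => f x i j) @ F --> l i j.
Proof. by move=> h; exact: (cvg_comp f (fun M => M i j) h (@coord_continuous R p n i j l)). Qed.

Lemma cvg_dotv (T : Type) (F : set_system T) {FF : Filter F}
    (f g : T -> 'cV[R]_m) (a b : 'cV[R]_m) :
  f @ F --> a -> g @ F --> b -> (fun x => dotv (f x) (g x)) @ F --> dotv a b.
Proof.
by move=> fa gb; apply: cvg_bigsum => i; apply: cvgM; exact: cvg_coord.
Qed.

Lemma cvg_enorm (T : Type) (F : set_system T) {FF : Filter F}
    (f : T -> 'cV[R]_m) (a : 'cV[R]_m) :
  f @ F --> a -> (fun x => enorm (f x)) @ F --> enorm a.
Proof.
move=> fa; exact: (cvg_comp _ Num.sqrt (cvg_dotv fa fa) (@sqrt_continuous R _)).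
Qed.

Lemma cvg_mulmx (T : Type) (F : set_system T) {FF : Filter F} (p q : nat)
    (f : T -> 'M[R]_(p, m)) (g : T -> 'M[R]_(m, q)) (a : 'M[R]_(p, m)) (b : 'M[R]_(m, q)) :
  f @ F --> a -> g @ F --> b -> (fun x => f x *m g x) @ F --> a *m b.
Proof.
move=> fa gb; apply: cvg_mx_entries => i j.
have -> : (fun x => (f x *m g x) i j) = (fun x => \sum_k f x i k * g x k j).
  by apply/funext => x; rewrite mxE.
by rewrite mxE; apply: cvg_bigsum => k; apply: cvgM; exact: cvg_coord.
Qed.

Lemma coord_normr (p n : nat) (M : 'M[R]_(p, n)) i j : `|M i j| <= `|M|.
Proof.
rewrite [leRHS]/Num.Def.normr/= mx_normrE.
exact: (le_bigmax _ (fun k => `|M k.1 k.2|) (i, j)).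
Qed.

Lemma normr_enorm (u : 'cV[R]_m) : `|u| <= enorm u.
Proof.
rewrite [leLHS]/Num.Def.normr/= mx_normrE bigmax_le// ?enorm_ge0// => -[i j] _ /=.
by rewrite ord1 coord_enorm.
Qed.

End enorm_continuity.

Section sphere_topology.
Context (R : realType) (d : nat).
Implicit Types x y : sphere R d.

Lemma enorm_spval x : enorm (spval x) = 1.
Proof. exact: (set_valP x). Qed.

Lemma dotv_spval x : dotv (spval x) (spval x) = 1.
Proof. by rewrite dotvv enorm_spval expr1n. Qed.

Lemma spval_inj : injective (@spval R d).
Proof. by move=> x y e; apply: val_inj. Qed.

Lemma spval_continuous : continuous (@spval R d).
Proof.
have := @initial_continuous (set_type (@unit_sphere R d)) 'cV[R]_d.+1 set_val.
by rewrite set_valE.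
Qed.

Lemma sphere_openP (U : set (sphere R d)) : open U ->
  exists2 W : set 'cV[R]_d.+1, open W & U = @spval R d @^-1` W.
Proof. by move=> [W oW <-]; exists W => //; rewrite set_valE. Qed.

Lemma normalizeE (y : 'cV[R]_d.+1) : y != 0 ->
  spval (normalize y) = (enorm y)^-1 *: y.
Proof.
move=> y0; rewrite /spval /normalize insubdK//; apply/mem_set => /=.
by rewrite /unit_sphere /= enormZ ger0_norm ?invr_ge0 ?enorm_ge0// mulVf// enorm_eq0.
Qed.

Lemma spval_neq0 x : spval x != 0.
Proof. by rewrite -enorm_eq0 enorm_spval oner_eq0. Qed.

Lemma normalize_spval x : normalize (spval x) = x.
Proof. by apply: spval_inj; rewrite normalizeE ?spval_neq0// enorm_spval invr1 scale1r. Qed.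

Lemma normalizeZ (a : R) (y : 'cV[R]_d.+1) : 0 < a -> y != 0 ->
  normalize (a *: y) = normalize y.
Proof.
move=> a0 y0; apply: spval_inj; rewrite !normalizeE// ?scaler_eq0 ?gt_eqF//.
by rewrite enormZ gtr0_norm// scalerA invfM mulrAC mulVf ?mul1r ?gt_eqF.
Qed.

Lemma unit_sphere_compact : compact (@unit_sphere R d).
Proof.
(* Heine-Borel is applied to row vectors and carried to columns by the continuous transposition. *)
pose S := [set v : 'rV[R]_d.+1 | enorm v^T = 1].
have ct : continuous (fun v : 'rV[R]_d.+1 => v^T).
  move=> v; apply: (@cvg_mx_entries _ _ _ _ (nbhs v)) => i j.
  have -> : (fun w : 'rV[R]_d.+1 => w^T i j) = (fun w => w j i).
    by apply/funext => w; rewrite mxE.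
  by rewrite mxE; exact: coord_continuous.
have -> : @unit_sphere R d = (fun v : 'rV[R]_d.+1 => v^T) @` S.
  apply/seteqP; split => [v vS|_ [v vS <-]//].
  by exists v^T; rewrite /S /= trmxK.
apply: continuous_compact; first exact: continuous_subspaceT.
apply: bounded_closed_compact.
- exists 1; split => // M M1 v vS; apply: ltW; apply: le_lt_trans M1.
  rewrite [leLHS]/Num.Def.normr/= mx_normrE bigmax_le//= => -[i j] _ /=.
  by have := coord_enorm v^T j; rewrite mxE vS ord1.
- apply: (@preimage_closed _ R (fun v : 'rV[R]_d.+1 => enorm v^T) [set 1]); last exact: closed_eq.
  by move=> v _; exact: (@cvg_enorm R d.+1 _ (nbhs v) _ (fun v => v^T) v^T (ct v)).
Qed.

(** The tube lemma for the compact sphere. It is the single source of uniformity in [x]: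
    boundedness, uniform continuity and uniform difference quotients are obtained by varying the
    filter [F]. *)
Lemma near_sphere (I : Type) (F : set_system I) (P : I -> sphere R d -> Prop) :
  Filter F -> (forall x, \forall x' \near x & i \near F, P i x') ->
  \forall i \near F, forall x, P i x.
Proof.
move=> FF h.
have /compact_near_coveringP/near_covering_withinP cov := unit_sphere_compact.
(* Compactness is a property of the subset of the ambient space, so the predicate is first rewritten
   for ambient vectors. *)
have := cov I F (fun i v => forall x, spval x = v -> P i x) FF.
move=> /(_ _)/filterS; apply; first by move=> i hi x; apply: (hi (spval x)) => //; exact: enorm_spval.
move=> v Sv.
pose x : sphere R d := SigSub (mem_set Sv).
have [[U V] /= [Ux FV] UVP] := h x.
have [W oW UW] : exists2 W, open W /\ W v & @spval R d @^-1` W `<=` U.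
  move: Ux; rewrite nbhsE => -[U' [oU' U'x] U'U].
  have [W oW e] := sphere_openP oU'.
  by exists W; [split => //; move: U'x; rewrite e|rewrite -e].
exists (W, V) => /=; first by split => //; exact: open_nbhs_nbhs.
by move=> [v' i] /= [Wv' Vi] _ y e; apply: (UVP (y, i)); split => //; apply: UW; rewrite /= e.
Qed.

End sphere_topology.

(** * Integration and couplings on the sphere *)

Section probability_integral.
Context (d : measure_display) (T : measurableType d) (R : realType).
Implicit Types (P : probability T R) (f g : T -> R).

Lemma bounded_integrable P f (M : R) : measurable_fun setT f ->
  (forall x, `|f x| <= M) -> P.-integrable setT (EFin \o f).
Proof.
move=> mf fM; apply: measurable_bounded_integrable => //.
  exact: fin_num_fun_lty.
exists M; split; first exact: num_real.
by move=> M' MM' x _; apply: le_trans (fM x) (ltW MM').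
Qed.

Lemma Rintegral_prob_cst P (c : R) : \int[P]_x c = c.
Proof. by rewrite Rintegral_cst//= probability_setT mulr1. Qed.

Lemma Rintegral_sum P (I : Type) (r : seq I) (f : I -> T -> R) :
  (forall i, P.-integrable setT (EFin \o f i)) ->
  \int[P]_x (\sum_(i <- r) f i x) = \sum_(i <- r) \int[P]_x f i x.
Proof.
move=> h; elim: r => [|i r ih].
  rewrite big_nil; under eq_Rintegral do rewrite big_nil.
  exact: Rintegral_prob_cst.
rewrite big_cons; under eq_Rintegral do rewrite big_cons.
rewrite RintegralD//; first by rewrite ih.
have -> : EFin \o (fun x => \sum_(j <- r) f j x) =
    (fun x => \sum_(j <- r) (EFin \o f j) x)%E.
  by apply/funext => x; rewrite /= sumEFin.
exact: integrable_sum.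
Qed.

Lemma Rintegral_EFin P f (M : R) : measurable_fun setT f ->
  (forall x, `|f x| <= M) -> (\int[P]_x (f x)%:E = (\int[P]_x f x)%:E)%E.
Proof.
move=> mf fM; rewrite /Rintegral fineK//.
by apply: integrable_fin_num => //; exact: bounded_integrable mf fM.
Qed.

Lemma le_Rintegral_prob P f g (M N : R) :
  measurable_fun setT f -> (forall x, `|f x| <= M) ->
  measurable_fun setT g -> (forall x, `|g x| <= N) ->
  (forall x, f x <= g x) -> \int[P]_x f x <= \int[P]_x g x.
Proof.
move=> mf fM mg gN fg; apply: le_Rintegral => //.
- exact: bounded_integrable mf fM.
- exact: bounded_integrable mg gN.
Qed.

Lemma Rintegral_dist_le P f g (M N e : R) :
  measurable_fun setT f -> (forall x, `|f x| <= M) ->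
  measurable_fun setT g -> (forall x, `|g x| <= N) ->
  (forall x, `|f x - g x| <= e) -> `|\int[P]_x f x - \int[P]_x g x| <= e.
Proof.
move=> mf fM mg gN fg.
have fi := bounded_integrable P mf fM; have gi := bounded_integrable P mg gN.
rewrite -RintegralB//.
have mfg : measurable_fun setT (fun x => f x - g x) by exact: measurable_funB.
have h1 := @bounded_integrable P _ _ mfg fg.
rewrite ler_norml; apply/andP; split.
  rewrite -(Rintegral_prob_cst P (- e)); apply: le_Rintegral => //.
    by apply: (@bounded_integrable P (fun=> - e) `|- e|).
  by move=> x _; have := fg x; rewrite ler_norml => /andP[].
rewrite -(Rintegral_prob_cst P e); apply: le_Rintegral => //.
  by apply: (@bounded_integrable P (fun=> e) `|e|).
by move=> x _; have := fg x; rewrite ler_norml => /andP[].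
Qed.

End probability_integral.

Section pushprob.
Context (d d' : measure_display) (T : measurableType d) (U : measurableType d')
  (R : realType) (P : probability T R) (f : T -> U) (mf : measurable_fun setT f).

Let mfun_mixin := isMeasurableFun.Build _ _ _ _ f mf.
Definition pushprob : probability U R :=
  distribution P (HB.pack f mfun_mixin : {mfun T >-> U}).

Lemma pushprobE A : pushprob A = P (f @^-1` A).
Proof. by []. Qed.

Lemma Rintegral_pushprob (g : U -> R) (M : R) : measurable_fun setT g ->
  (forall x, `|g x| <= M) -> \int[pushprob]_y g y = \int[P]_x g (f x).
Proof.
move=> mg gM; rewrite /Rintegral; congr fine.
rewrite (@integral_pushforward _ _ _ _ _ f mf P setT (EFin \o g)) ?preimage_setT//.
  exact/measurable_EFinP.
apply: (@bounded_integrable _ _ _ P (g \o f) M) => [|x]; last exact: gM.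
exact: measurableT_comp.
Qed.

End pushprob.

Section sphere_measure.
Context (R : realType) (d : nat).
Notation S := (sphere R d).
Implicit Types (mu nu : probability S R).

Lemma open_sphere_measurable (U : set S) : open U -> measurable U.
Proof. by move=> oU; exact: sub_sigma_algebra. Qed.

Lemma continuous_sphere_measurable (f : S -> R) : continuous f ->
  measurable_fun setT f.
Proof.
move=> cf; apply: (measurability _ (RGenOpens.measurableE R)).
move=> _ [_ [a [b ->]] <-]; rewrite setTI; apply: open_sphere_measurable.
by move/continuousP: cf; apply; exact: itv_open.
Qed.

Lemma continuous_sphere_bounded (f : S -> R) : continuous f ->
  exists M, forall x, `|f x| <= M.
Proof.
move=> cf.
have : \forall M \near +oo, forall x, `|f x| <= M.
  apply: near_sphere => x.
  have h1 : \forall x' \near x, `|f x - f x'| < 1.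
    by move/cvgrPdist_lt: (cf x) => /(_ _ ltr01).
  have h2 : \forall M \near +oo, `|f x| + 1 <= M.
    by apply: nbhs_pinfty_ge; exact: num_real.
  exists ([set x' | `|f x - f x'| < 1], [set M | `|f x| + 1 <= M]) => //=.
  move=> [x' M] /= [h3 h4]; apply: le_trans h4.
  have := ler_normB (f x) (f x - f x'); rewrite subKr; move: h3; lra.
by move=> /(@filter_ex _ _ _)[M hM]; exists M.
Qed.

Lemma continuous_sphere_integrable (f : S -> R) mu : continuous f ->
  mu.-integrable setT (EFin \o f).
Proof.
move=> cf; have [M fM] := continuous_sphere_bounded cf.
by apply: bounded_integrable fM; exact: continuous_sphere_measurable.
Qed.

(* Uniform continuity, in a form that survives integration against a coupling. *)
Lemma continuous_sphere_modulus (f : S -> R) (e : R) : continuous f -> 0 < e ->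
  exists2 K, 0 < K & forall x y, `|f x - f y| <= e + K * enorm (spval x - spval y).
Proof.
move=> cf e0; have [M fM] := continuous_sphere_bounded cf.
have : \forall r \near 0^'+, forall x, forall y, enorm (spval x - spval y) < r ->
    `|f x - f y| <= e.
  apply: near_sphere => x.
  have e2 : 0 < e / 2 by rewrite divr_gt0.
  have : nbhs x [set x' | `|f x - f x'| < e / 2].
    by move/cvgrPdist_lt: (cf x) => /(_ _ e2).
  rewrite nbhsE => -[U [oU Ux] UP].
  have [W oW UW] := sphere_openP oU.
  have : nbhs (spval x) W by apply: open_nbhs_nbhs; split => //; move: Ux; rewrite UW.
  move=> /nbhs_normP [r /= r0 rW].
  have near_in y : enorm (spval x - spval y) < r -> `|f x - f y| < e / 2.
    move=> h; apply: UP; rewrite UW /=; apply: rW => /=.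
    exact: le_lt_trans (normr_enorm _) h.
  exists ([set x' | enorm (spval x - spval x') < r / 2], [set r' | r' < r / 2]) => /=.
    split; last by apply: nbhs_right_lt; rewrite divr_gt0.
    have : (fun x' : S => enorm (spval x - spval x')) @ x --> enorm (spval x - spval x).
      apply: (@cvg_enorm _ _ _ (nbhs x)); apply: cvgB; first exact: cvg_cst.
      exact: spval_continuous.
    rewrite subrr enorm0 => /cvgrPdist_lt/(_ (r / 2)); rewrite divr_gt0// => /(_ isT).
    by apply: filterS => x'; rewrite sub0r normrN; apply: le_lt_trans; exact: ler_norm.
  move=> [x' r'] /= [h1 h2] y h3.
  have h4 : `|f x - f x'| < e / 2 by apply: near_in; move: h1; have := r0; lra.
  have h5 : `|f x - f y| < e / 2.
    apply: near_in; apply: le_lt_trans (_ : _ <= enorm (spval x - spval x') + enorm (spval x' - spval y)) _.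
      by rewrite -{1}(subrK (spval x') (spval x)) -addrA enormD.
    move: h1 h2 h3; lra.
  have := ler_normB (f x - f y) (f x - f x'); rewrite opprB addrC addrA subrK.
  move: h4 h5; lra.
move=> h; have [r [r0 hr]] := filter_ex (filterI (nbhs_right_gt 0) h).
have M0 : 0 <= M by exact: le_trans (normr_ge0 _) (fM point).
(* Points closer than [r] are covered by [e] alone; for the others the oscillation [2 * M] is at
   most [2 * M / r] times their distance. The [+ 1] makes the constant positive. *)
exists (2 * M / r + 1); first by rewrite ltr_wpDl// divr_ge0 ?mulr_ge0// ltW.
move=> x y; set D := enorm _; have D0 : 0 <= D by exact: enorm_ge0.
have [Dr|rD] := ltP D r.
  apply: le_trans (hr x y Dr) _; rewrite lerDl mulr_ge0// addr_ge0// divr_ge0 ?mulr_ge0//.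
  exact: ltW.
have : `|f x - f y| <= 2 * M.
  by have := ler_normB (f x) (f y); have := fM x; have := fM y; lra.
move=> /le_trans; apply.
have h1 : 2 * M <= 2 * M / r * D.
  by rewrite mulrAC ler_pdivlMr ?ler_wpM2l// mulr_ge0.
rewrite mulrDl mul1r; have := e0; lra.
Qed.

Lemma dist_sphere_le2 (x y : S) : enorm (spval x - spval y) <= 2.
Proof. by have := enormB (spval x) (spval y); rewrite !enorm_spval. Qed.

Lemma measurable_dist_sphere :
  measurable_fun setT (fun z : S * S => enorm (spval z.1 - spval z.2)).
Proof.
rewrite (_ : (fun z : S * S => _) = Num.sqrt \o
  (fun z : S * S => \sum_i (spval z.1 - spval z.2) i 0 ^+ 2)); last by [].
apply: measurableT_comp.
  exact: continuous_measurable_fun (@sqrt_continuous R).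
apply: measurable_sum => i; apply: measurable_funX.
have -> : (fun z : S * S => (spval z.1 - spval z.2) i 0) =
    (fun z => spval z.1 i 0 - spval z.2 i 0).
  by apply/funext => z; rewrite !mxE.
have mc : measurable_fun setT (fun x : S => spval x i 0).
  apply: continuous_sphere_measurable => x.
  exact: cvg_coord (@spval_continuous R d x).
by apply: measurable_funB; apply: (measurableT_comp mc).
Qed.

Definition cost (pi : probability (S * S)%type R) : R :=
  \int[pi]_z enorm (spval z.1 - spval z.2).

Lemma costE (pi : probability (S * S)%type R) :
  (\int[pi]_z (enorm (spval z.1 - spval z.2))%:E = (cost pi)%:E)%E.
Proof.
apply: (@Rintegral_EFin _ _ _ pi _ 2 measurable_dist_sphere) => z.
by rewrite ger0_norm ?enorm_ge0// dist_sphere_le2.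
Qed.

Lemma cost_ge0 pi : 0 <= cost pi.
Proof. by apply: Rintegral_ge0 => z _; exact: enorm_ge0. Qed.

Lemma cost_le2 pi : cost pi <= 2.
Proof.
rewrite -(Rintegral_prob_cst pi 2); apply: (@le_Rintegral_prob _ _ _ pi _ _ 2 2) => //.
- exact: measurable_dist_sphere.
- by move=> z; rewrite ger0_norm ?enorm_ge0// dist_sphere_le2.
- by move=> z; rewrite ger0_norm.
- by move=> z; exact: dist_sphere_le2.
Qed.

Lemma W1_le_cost mu nu pi : coupling mu nu pi -> (W1 mu nu <= (cost pi)%:E)%E.
Proof. by move=> h; apply: ereal_inf_lbound; exists pi => //; exact: costE. Qed.

Lemma W1_ge0 mu nu : (0 <= W1 mu nu)%E.
Proof.
apply: le_ereal_inf_tmp => _ [pi _ <-]; rewrite costE lee_fin; exact: cost_ge0.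
Qed.

Lemma W1_lt_coupling mu nu (w : R) : (W1 mu nu < w%:E)%E ->
  exists2 pi, coupling mu nu pi & cost pi < w.
Proof.
move=> /ereal_inf_lt[_ [pi h <-]]; rewrite costE lte_fin => h2.
by exists pi.
Qed.

Lemma Rintegral_marginals mu nu pi (f : S -> R) (M : R) : coupling mu nu pi ->
  measurable_fun setT f -> (forall x, `|f x| <= M) ->
  \int[mu]_x f x = \int[pi]_z f z.1 /\ \int[nu]_x f x = \int[pi]_z f z.2.
Proof.
move=> h mf fM; split.
  rewrite -(@Rintegral_pushprob _ _ _ _ R pi fst measurable_fst f M)//.
  congr fine; apply: eq_measure_integral => A mA _.
  have [h1 _] := h A mA; apply: (etrans (esym h1)).
  suff -> : A `*` setT = @fst S S @^-1` A by [].
  by apply/seteqP; split => [z []//|z]; split.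
rewrite -(@Rintegral_pushprob _ _ _ _ R pi snd measurable_snd f M)//.
congr fine; apply: eq_measure_integral => A mA _.
have [_ h2] := h A mA; apply: (etrans (esym h2)).
suff -> : setT `*` A = @snd S S @^-1` A by [].
by apply/seteqP; split => [z []//|z]; split.
Qed.

(** The easy half of Kantorovich duality: integrate the pointwise bound against a coupling of cost
    below [w]. The affine modulus makes it apply to every continuous [f], so [W1]-convergence
    implies weak convergence. *)
Lemma Rintegral_W1 mu nu (f : S -> R) (e K w : R) : 0 <= K ->
  measurable_fun setT f -> (exists M, forall x, `|f x| <= M) ->
  (forall x y, `|f x - f y| <= e + K * enorm (spval x - spval y)) ->
  (W1 mu nu < w%:E)%E -> `|\int[mu]_x f x - \int[nu]_x f x| <= e + K * w.
Proof.
move=> K0 mf [M fM] fe /W1_lt_coupling[pi hpi hw].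
have [-> ->] := Rintegral_marginals hpi mf fM.
have m1 : measurable_fun setT (fun z : S * S => f z.1) by exact: measurableT_comp.
have m2 : measurable_fun setT (fun z : S * S => f z.2) by exact: measurableT_comp.
have i1 : pi.-integrable setT (EFin \o (fun z : S * S => f z.1)).
  by apply: (@bounded_integrable _ _ _ pi _ (M)).
have i2 : pi.-integrable setT (EFin \o (fun z : S * S => f z.2)).
  by apply: (@bounded_integrable _ _ _ pi _ (M)).
rewrite -RintegralB//; apply: (@le_trans _ _ (e + K * cost pi)); last first.
  by rewrite lerD2l ler_wpM2l// ltW.
have md : measurable_fun setT (fun z : S * S => f z.1 - f z.2) by exact: measurable_funB.
have bd (z : S * S) : `|f z.1 - f z.2| <= 2 * M.
  by have := ler_normB (f z.1) (f z.2); have := fM z.1; have := fM z.2; lra.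
apply: le_trans (le_normr_Rintegral _ _) _ => //.
  by apply: (@bounded_integrable _ _ _ pi _ (2 * M)).
have mc := measurable_dist_sphere.
have ic : pi.-integrable setT (EFin \o (fun z : S * S => enorm (spval z.1 - spval z.2))).
  by apply: (@bounded_integrable _ _ _ pi _ (2)) => // z; rewrite ger0_norm ?enorm_ge0// dist_sphere_le2.
have -> : e + K * cost pi = \int[pi]_z (e + K * enorm (spval z.1 - spval z.2)).
  rewrite RintegralD//.
  - by rewrite Rintegral_prob_cst RintegralZl.
  - exact: (@bounded_integrable _ _ _ pi _ (`|e|)).
  - apply: (@bounded_integrable _ _ _ pi _ (K * 2)) => [|z].
      exact: measurable_funM.
    by rewrite normrM (ger0_norm K0) ler_wpM2l// ger0_norm ?enorm_ge0// dist_sphere_le2.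
apply: (@le_Rintegral_prob _ _ _ pi _ _ (2 * M) (`|e| + K * 2)).
- exact: measurableT_comp.
- by move=> z; rewrite normr_id.
- apply: measurable_funD => //; exact: measurable_funM.
- move=> z; apply: le_trans (ler_normD _ _) _; rewrite lerD2l normrM (ger0_norm K0).
  by rewrite ler_wpM2l// ger0_norm ?enorm_ge0// dist_sphere_le2.
- by move=> z; exact: fe.
Qed.

(** Against a Dirac mass the product coupling is the image of [mu] under [x |-> (x, x0)]; the bound
    is the diameter of the sphere. *)
Lemma W1_dirac_le2 mu (x0 : S) :
  (W1 mu [the probability S R of \d_x0] <= 2%:E)%E.
Proof.
have m1 : measurable_fun setT (fun x : S => (x, x0)) by exact: pair2_measurable.
apply: le_trans (@W1_le_cost _ _ (pushprob mu m1) _) _; last by rewrite lee_fin cost_le2.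
move=> A mA; split.
  rewrite pushprobE.
  suff -> : (fun x => (x, x0)) @^-1` (A `*` setT) = A by [].
  by apply/seteqP; split => [x []//|x]; split.
rewrite pushprobE /= diracE; have [xA|xA] := boolP (x0 \in A).
  suff -> : (fun x => (x, x0)) @^-1` (setT `*` A) = [set: S].
    exact: probability_setT.
  by apply/seteqP; split => // x _; split => //=; rewrite inE in xA.
suff -> : (fun x => (x, x0)) @^-1` (setT `*` A) = set0 :> set S by rewrite measure0.
by apply/seteqP; split => // x [_ /=]; move/mem_set; rewrite (negPf xA).
Qed.

End sphere_measure.

(** * Differentiable functions on the sphere *)

Section C1_functions.
Context (R : realType) (m : nat).
Notation V := 'cV[R]_m.+1.
Implicit Types (f g : V -> R) (G H : V -> V).

(** The difference [g - f] vanishes near [y], hence is differentiable there with differential 0, and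
    can be added to [f]. *)
Lemma near_eq_differentiable f g (y : V) : (\forall z \near y, f z = g z) ->
  differentiable (f : V -> R^o) y -> differentiable (g : V -> R^o) y.
Proof.
move=> fg df.
pose h : V -> R^o := fun z => g z - f z.
have e : h \o shift y = cst (h y) + (\0 : V -> R^o) +o_ (0 : V) id.
  apply/eqaddoP => _/posnumP[eps].
  have h0 : \forall z \near y, h z = 0.
    by apply: filterS fg => z; rewrite /h => ->; rewrite subrr.
  have hy : h y = 0 by exact: nbhs_singleton h0.
  move: h0; rewrite (near_shift (0 : V)) subr0; apply: filterS => z /= hz.
  by rewrite !fctE /= hz hy addr0 subr0 normr0 mulr_ge0.
have c0 : continuous (\0 : V -> R^o).
  by rewrite (_ : \0 = cst 0) //; exact: cst_continuous.
have d0 : 'd h y = \0 :> (V -> R^o) by exact: diff_unique c0 e.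
have hd : differentiable h y.
  apply/diff_locallyP; rewrite d0; split; [exact: c0|exact: e].
have -> : (g : V -> R^o) = (f : V -> R^o) + h.
  by apply/funext => z; rewrite /h fctE addrC subrK.
exact: differentiableD.
Qed.

(** Being [C^1] off the origin, where 0-homogeneous extensions may be singular. The gradient is a
    parameter, so that the rules below compute it instead of merely asserting its existence. *)
Definition C1grad f G := forall y, y != 0 ->
  [/\ differentiable (f : V -> R^o) y,
      forall v, 'd (f : V -> R^o) y v = dotv (G y) v &
      {for y, continuous G}].

Lemma open_neq0 (y : V) : y != 0 -> \forall z \near y, z != 0.
Proof.
move=> y0; exact: (cvgr_neq0 y (@cvg_id _ (nbhs y)) y0).
Qed.

Lemma C1grad_eq f g G : (forall y, y != 0 -> f y = g y) -> C1grad f G -> C1grad g G.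
Proof.
move=> fg hf y y0; have [df dv cG] := hf y y0.
have near_fg : \forall z \near y, f z = g z by apply: filterS (open_neq0 y0).
have dg := near_eq_differentiable near_fg df.
split => // v; rewrite -deriveE// -dv -deriveE//; apply/esym.
exact: near_eq_derive.
Qed.

Lemma C1grad_cst (c : R) : C1grad (fun=> c) (fun=> 0).
Proof.
move=> y y0; split; first exact: (@differentiable_cst R V R^o c y).
  move=> v; rewrite (@diff_cst R V R^o) /dotv big1// => i _.
  by rewrite mxE mul0r.
exact: cst_continuous.
Qed.

Lemma C1grad_add f g G H : C1grad f G -> C1grad g H ->
  C1grad (fun y => f y + g y) (fun y => G y + H y).
Proof.
move=> hf hg y y0; have [df dv cG] := hf y y0; have [dg dw cH] := hg y y0.
split; first exact: (@differentiableD R V R^o f g y).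
  by move=> v; rewrite (@diffD R V R^o f g y)//= dv dw dotvDl.
exact: (continuousD (f := G) (g := H)).
Qed.

Lemma C1grad_mul f g G H : C1grad f G -> C1grad g H ->
  C1grad (fun y => f y * g y) (fun y => f y *: H y + g y *: G y).
Proof.
move=> hf hg y y0; have [df dv cG] := hf y y0; have [dg dw cH] := hg y y0.
have cf : {for y, continuous f} by exact: differentiable_continuous df.
have cg : {for y, continuous g} by exact: differentiable_continuous dg.
split; first exact: (@differentiableM R V f g y).
  move=> v; rewrite (@diffM R V f g y)// dotvDl !dotvZl -dv -dw.
  by [].
exact: (continuousD (f := fun y => f y *: H y) (g := fun y => g y *: G y)
  (cvgZ cf cH) (cvgZ cg cG)).
Qed.

(** Regularity of the outer function is asked only at values [f y] with [y != 0]; this admits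
    [r |-> 1 / sqrt r] at [r = |y|^2]. *)
Lemma C1grad_comp (theta dtheta : R -> R) f G :
  (forall y : V, y != 0 -> is_derive (f y) 1 theta (dtheta (f y))) ->
  (forall y : V, y != 0 -> {for f y, continuous dtheta}) ->
  C1grad f G -> C1grad (fun y => theta (f y)) (fun y => dtheta (f y) *: G y).
Proof.
move=> ht ht' hf y y0; have [df dv cG] := hf y y0.
have dt := ht y y0; have ct := ht' y y0.
have cf : {for y, continuous f} by exact: differentiable_continuous df.
have dth : differentiable (theta : R^o -> R^o) (f y) by apply/derivable1_diffP; case: dt.
split; first exact: (@differentiable_comp R V R^o R^o f theta y).
  move=> v; rewrite (@diff_comp R V R^o R^o f theta y)//= dv dotvZl.
  rewrite diff1E//= derive1E; case: dt => _ ->.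
  by rewrite /GRing.scale /= mulrC.
exact: (cvgZ (cvg_comp f dtheta cf ct) cG).
Qed.

Lemma C1grad_dotv (q : V) : C1grad (dotv q) (fun=> q).
Proof.
move=> y y0.
have lq : linear (dotv q : V -> R^o) by move=> a u v; rewrite dotvDr dotvZr.
pose lqM := GRing.isLinear.Build _ _ _ _ _ lq.
pose lqL : {linear V -> R^o} := HB.pack (dotv q : V -> R^o) lqM.
have cq : continuous lqL.
  move=> z; apply: (@cvg_dotv _ _ _ (nbhs z)); [exact: cvg_cst|exact: cvg_id].
split; first exact: (@linear_differentiable R V R^o lqL y).
  by move=> v; rewrite (@diff_lin R V R^o lqL y).
exact: cst_continuous.
Qed.

Lemma C1grad_sum (I : Type) (r : seq I) (f : I -> V -> R) (G : I -> V -> V) :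
  (forall i, C1grad (f i) (G i)) ->
  C1grad (fun y => \sum_(i <- r) f i y) (fun y => \sum_(i <- r) G i y).
Proof.
move=> h; elim: r => [|i r ih].
  have -> : (fun y : V => \sum_(i <- [::]) f i y) = (fun=> 0).
    by apply/funext => y; rewrite big_nil.
  have -> : (fun y : V => \sum_(i <- [::]) G i y) = (fun=> 0).
    by apply/funext => y; rewrite big_nil.
  exact: C1grad_cst.
have -> : (fun y => \sum_(j <- i :: r) f j y) = (fun y => f i y + \sum_(j <- r) f j y).
  by apply/funext => y; rewrite big_cons.
have -> : (fun y => \sum_(j <- i :: r) G j y) = (fun y => G i y + \sum_(j <- r) G j y).
  by apply/funext => y; rewrite big_cons.
exact: C1grad_add.
Qed.

Lemma C1grad_mulmx (N : 'M[R]_m.+1) f G : N \in unitmx -> C1grad f G ->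
  C1grad (fun y => f (N *m y)) (fun y => N^T *m G (N *m y)).
Proof.
move=> uN hf y y0.
have Ny0 := unitmx_mul_neq0 uN y0.
have [df dv cG] := hf _ Ny0.
have lN : linear (fun z : V => N *m z) by move=> a u v; rewrite mulmxDr scalemxAr.
pose lNM := GRing.isLinear.Build _ _ _ _ _ lN.
pose lNL : {linear V -> V} := HB.pack (fun z : V => N *m z) lNM.
have cN : continuous lNL.
  move=> z; apply: (@cvg_mulmx _ _ _ (nbhs z)); [exact: cvg_cst|exact: cvg_id].
have dN := @linear_differentiable R V V lNL y cN.
split; first exact: (@differentiable_comp R V V R^o lNL f y).
  move=> v; rewrite (@diff_comp R V V R^o lNL f y)//= dv.
  by rewrite (@diff_lin R V V lNL y)//= dotv_mulmx trmxK.
apply: (@cvg_mulmx _ _ _ (nbhs y)); first exact: cvg_cst.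
exact: (cvg_comp lNL G (cN y) cG).
Qed.

Lemma C1grad_gradient f G (y : V) : C1grad f G -> y != 0 -> gradient f y = G y.
Proof.
move=> hf y0; have [df dv _] := hf y y0.
apply/matrixP => i j; rewrite ord1 mxE deriveE// dv /dotv (bigD1 i)//= big1 ?addr0.
  by rewrite mxE !eqxx mulr1.
by move=> k ki; rewrite mxE (negPf ki) mulr0.
Qed.

Lemma differentiable_gradient f (y v : V) : differentiable (f : V -> R^o) y ->
  'd (f : V -> R^o) y v = dotv (gradient f y) v.
Proof.
move=> df; have e : v = \sum_i (v i 0) *: delta_mx i 0.
  by rewrite {1}(matrix_sum_delta v); apply: eq_bigr => i _; rewrite big_ord1.
rewrite {1}e linear_sum; apply: eq_bigr => i _.
by rewrite linearZ /= mxE deriveE// mulrC.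
Qed.

End C1_functions.

Section C1_sphere.
Context (R : realType) (d : nat).
Notation V := 'cV[R]_d.+1.
Notation S := (sphere R d).
Implicit Types (phi : S -> R).

Lemma C1_sphere_C1grad phi : C1_sphere phi ->
  C1grad (hext phi) (gradient (hext phi)).
Proof.
move=> h y y0; have [df cg] := h y y0; split => // v.
exact: differentiable_gradient.
Qed.

Lemma C1grad_C1_sphere phi (G : V -> V) : C1grad (hext phi) G -> C1_sphere phi.
Proof.
move=> h y y0; have [df dv cG] := h y y0; split => //.
rewrite /prop_for /continuous_at (C1grad_gradient h y0).
have e : \forall z \near y, G z = gradient (hext phi) z.
  by apply: filterS (open_neq0 y0) => z z0; rewrite (C1grad_gradient h z0).
exact: (cvg_trans (near_eq_cvg e) cG).
Qed.

Lemma hextZ phi (a : R) (y : V) : 0 < a -> y != 0 -> hext phi (a *: y) = hext phi y.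
Proof. by move=> a0 y0; rewrite /hext normalizeZ. Qed.

Lemma hext_spval phi (x : S) : hext phi (spval x) = phi x.
Proof. by rewrite /hext normalize_spval. Qed.

(* Euler's identity for the 0-homogeneous extension. *)
Lemma gradient_hext_radial phi (y : V) : C1_sphere phi -> y != 0 ->
  dotv (gradient (hext phi) y) y = 0.
Proof.
move=> h y0; have [df _] := h y y0.
rewrite -differentiable_gradient// -deriveE//.
apply: (@cvg_lim R^o); first exact: Rhausdorff.
apply: cvg_near_cst; near=> t.
rewrite /= (_ : t *: y + y = (t + 1) *: y); last by rewrite scalerDl scale1r.
rewrite hextZ// ?subrr ?scaler0//.
have : `|t| < 1 by near: t; exact: dnbhs0_lt.
by rewrite ltr_norml; lra.
Unshelve. all: by end_near. Qed.

Lemma C1_sphere_continuous phi : C1_sphere phi -> continuous phi.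
Proof.
move=> h x; have [df _] := h _ (spval_neq0 x).
have cf : {for spval x, continuous (hext phi)} by exact: differentiable_continuous df.
have -> : phi = hext phi \o @spval R d by apply/funext => z; rewrite /= hext_spval.
exact: continuous_comp (@spval_continuous R d x) cf.
Qed.

Lemma C1_sphere_gradient_continuous phi : C1_sphere phi ->
  continuous (fun x : S => gradient (hext phi) (spval x)).
Proof.
move=> h x; have [_ cg] := h _ (spval_neq0 x).
exact: (continuous_comp (f := @spval R d) (g := gradient (hext phi)) (@spval_continuous R d x) cg).
Qed.

(** Homogeneity of degree 0 absorbs both normalizations, so the nonlinear action of [N] on the
    sphere becomes a linear substitution in the extension. *)
Lemma hext_normalize_mulmx phi (N : 'M[R]_d.+1) (y : V) : N \in unitmx -> y != 0 ->
  hext (fun x => phi (normalize (N *m spval x))) y = hext phi (N *m y).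
Proof.
move=> uN y0; have Ny0 := unitmx_mul_neq0 uN y0.
by rewrite /hext normalizeE// -scalemxAr normalizeZ// invr_gt0 enorm_gt0.
Qed.

Lemma C1grad_pullback phi (N : 'M[R]_d.+1) : N \in unitmx -> C1_sphere phi ->
  C1grad (hext (fun x => phi (normalize (N *m spval x))))
    (fun y => N^T *m gradient (hext phi) (N *m y)).
Proof.
move=> uN h; apply: (@C1grad_eq _ _ (fun y => hext phi (N *m y))).
  by move=> y y0; rewrite hext_normalize_mulmx.
exact: C1grad_mulmx uN (C1_sphere_C1grad h).
Qed.

(** The projection subtracts a multiple of [x], which a tangent vector [g] does not see: against
    test functions the field of the equation acts like the linear one. *)
Lemma dotv_bfield (F : probability S R -> 'M[R]_d.+1) (g : V) (x : S) mu :
  dotv g (spval x) = 0 -> dotv g (bfield F x mu) = dotv g (F mu *m spval x).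
Proof.
move=> h; rewrite /bfield mulmxBl mul1mx dotvBr.
by rewrite -mulmxA dotv_mx mul_mx_scalar dotvZr h mulr0 subr0.
Qed.

Lemma is_derive_curve phi (y : R -> V) (v : V) (t : R) : C1_sphere phi ->
  y t != 0 -> (forall i, is_derive t 1 (fun s => y s i 0) (v i 0)) ->
  is_derive t 1 (fun s => hext phi (y s)) (dotv (gradient (hext phi) (y t)) v).
Proof.
move=> h y0 hy; have [df _] := h _ y0.
have dy : derivable y t 1.
  by apply/derivable_mxP => i j; rewrite ord1; case: (hy i).
have ey : 'D_1 y t = v.
  rewrite derive_mx//; apply/matrixP => i j; rewrite !mxE ord1.
  by case: (hy i) => _ ->.
have dy' : differentiable y t by apply/derivable1_diffP.
apply: DeriveDef.
  apply/derivable1_diffP; exact: (@differentiable_comp R R^o V R^o y (hext phi) t).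
rewrite deriveE; last exact: (@differentiable_comp R R^o V R^o y (hext phi) t).
rewrite (@diff_comp R R^o V R^o y (hext phi) t)//= differentiable_gradient//.
by rewrite -deriveE// ey.
Qed.

End C1_sphere.

(** * Transport of weak solutions along the characteristics *)

Lemma is_derive_cvgP (R : realType) (f : R -> R) (a l : R) :
  is_derive a 1 f l <-> (fun h => h^-1 * (f (h + a) - f a)) @ 0^' --> l.
Proof.
have e : (fun h => h^-1 *: ((f \o shift a) (h *: (1 : R)) - f a)) =
    (fun h => h^-1 * (f (h + a) - f a)).
  by apply/funext => h; rewrite /= /GRing.scale /= mulr1.
split=> [[df <-]|h].
  by rewrite -e; exact: df.
apply: DeriveDef; first by apply/cvg_ex; exists l; rewrite /= e.
by rewrite /derive e; apply: cvg_lim => //; exact: Rhausdorff.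
Qed.

Section linear_flow.
Context (R : realType) (n : nat) (A : R -> 'M[R]_n) (K : R).
Hypothesis Ac : forall i j, continuous (fun t => A t i j).
Hypothesis AK : forall t i j, `|A t i j| <= K.

(** The inverse of [G] is built from its own equation [H' = - H A], which after transposition is a
    linear system with matrix [- A^T]. Then [H G] has derivative 0 and starts at 1. *)
Lemma linear_flow_exists : exists G H : R -> 'M[R]_n,
  [/\ forall i j, continuous (fun t => G t i j) /\ continuous (fun t => H t i j),
      forall t, t <= 0 -> G t = 1%:M /\ H t = 1%:M,
      (forall t : R, 0 < t -> forall i j,
        is_derive t 1 (fun s => G s i j) ((A t *m G t) i j)),
      (forall t : R, 0 < t -> forall i j,
        is_derive t 1 (fun s => H s i j) (- (H t *m A t) i j)) &
      forall t, H t *m G t = 1%:M].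
Proof.
have [G [Gc G0 dG]] := linear_ode_exists Ac AK.
have Bc i j : continuous (fun t => (- (A t)^T) i j).
  have -> : (fun t => (- (A t)^T) i j) = (fun t => - A t j i).
    by apply/funext => t; rewrite !mxE.
  by move=> t; apply: continuousN; exact: Ac.
have BK t i j : `|(- (A t)^T) i j| <= K by rewrite !mxE normrN.
have [H [Hc H0 dH]] := linear_ode_exists Bc BK.
have dH' (t : R) : 0 < t -> forall i j,
    is_derive t 1 (fun s => (H s)^T i j) (- ((H t)^T *m A t) i j).
  move=> t0 i j.
  have -> : (fun s => (H s)^T i j) = (fun s => H s j i) by apply/funext => s; rewrite mxE.
  have -> : - ((H t)^T *m A t) i j = (- (A t)^T *m H t) j i.
    by rewrite mulNmx -(trmxK (H t)) -trmx_mul !mxE trmxK.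
  exact: dH.
exists G, (fun t => (H t)^T); split => //.
- move=> i j; split; first exact: Gc.
  have -> : (fun s => (H s)^T i j) = (fun s => H s j i) by apply/funext => s; rewrite mxE.
  exact: Hc.
- by move=> t t0; rewrite G0// H0// trmx1.
have cP i j : continuous (fun s => ((H s)^T *m G s) i j).
  move=> t; apply: cvg_coord; apply: (@cvg_mulmx _ _ _ (nbhs t)).
    apply: cvg_mx_entries => i' j'.
    have -> : (fun s => (H s)^T i' j') = (fun s => H s j' i') by apply/funext => s; rewrite mxE.
    by rewrite mxE; exact: Hc.
  by apply: cvg_mx_entries => i' j'; exact: Gc.
move=> t; have [t0|t0] := leP t 0; first by rewrite G0// H0// trmx1 mulmx1.
apply/matrixP => i j.
have dP (s : R) : 0 < s -> is_derive s 1 (fun s => ((H s)^T *m G s) i j) 0.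
  move=> s0.
  have -> : (fun s => ((H s)^T *m G s) i j) = (fun s => \sum_k (H s)^T i k * G s k j).
    by apply/funext => u; rewrite mxE.
  apply: is_derive_eq (is_derive_bigsum _ (fun k => is_derive_mul (dH' s s0 i k) (dG s s0 k j))) _.
  rewrite big_split /=.
  have -> : \sum_k - ((H s)^T *m A s) i k * G s k j = - ((H s)^T *m A s *m G s) i j.
    by rewrite [in RHS]mxE -sumrN; apply: eq_bigr => k _; rewrite mulNr.
  have -> : \sum_k (H s)^T i k * (A s *m G s) k j = ((H s)^T *m (A s *m G s)) i j.
    by rewrite [in RHS]mxE.
  by rewrite mulmxA addNr.
have [c _] := @MVT R _ (fun=> 0) 0 t t0
  (fun x h => dP x ltac:(by move: h; rewrite in_itv => /andP[]))
  (continuous_subspaceT (cP i j)).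
rewrite mul0r (G0 0 (lexx _)) (H0 0 (lexx _)) trmx1 mulmx1 => /eqP.
by rewrite subr_eq0 => /eqP.
Qed.

End linear_flow.

(** * Integrals of time-dependent test functions *)

Section moving_test_function.
Context (R : realType) (d : nat).
Notation S := (sphere R d).
Variable rho : R -> probability S R.
Hypothesis rho_cont : forall f : S -> R, continuous f ->
  continuous (fun s => \int[rho s]_x f x).

(** The change of test function is uniformly small by compactness, hence small against every
    probability measure; the change of measure is tested on the fixed function [phi s]. *)
Lemma moving_continuous (phi : R -> S -> R) (s : R) :
  (forall r, continuous (phi r)) ->
  (forall x, {for (s, x), continuous (fun p : R * S => phi p.1 p.2)}) ->
  {for s, continuous (fun r => \int[rho r]_x phi r x)}.
Proof.
move=> cphi jc; apply/cvgrPdist_le => e e0.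
have e2 : 0 < e / 2 by rewrite divr_gt0.
have e4 : 0 < e / 4 by rewrite divr_gt0.
have unif : \forall r \near s, forall x, `|phi r x - phi s x| <= e / 2.
  apply: (@near_sphere R d R (nbhs s) (fun r x => `|phi r x - phi s x| <= e / 2)) => x.
  have [[U V] /= [Us Vx] UV] : \forall p \near (s, x), `|phi s x - phi p.1 p.2| < e / 4.
    by move/cvgrPdist_lt: (jc x) => /(_ _ e4).
  exists (V, U) => //= -[x' r] /= [Vx' Ur].
  have h1 := UV (r, x') (conj Ur Vx'); have h2 := UV (s, x') (conj (nbhs_singleton Us) Vx').
  move: h1 h2 => /=; rewrite !ltr_norml ler_norml; lra.
have J : \forall r \near s, `|\int[rho s]_x phi s x - \int[rho r]_x phi s x| <= e / 2.
  by move/cvgrPdist_le: (@rho_cont _ (cphi s) s) => /(_ _ e2).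
near=> r.
have h1 : `|\int[rho s]_x phi s x - \int[rho r]_x phi s x| <= e / 2 by near: r.
have h2 : `|\int[rho r]_x phi r x - \int[rho r]_x phi s x| <= e / 2.
  have [M1 b1] := continuous_sphere_bounded (cphi r).
  have [M2 b2] := continuous_sphere_bounded (cphi s).
  apply: (@Rintegral_dist_le _ _ _ _ _ _ M1 M2) => //.
  - exact: continuous_sphere_measurable.
  - exact: continuous_sphere_measurable.
  - by near: r.
by move: h1 h2; rewrite !ler_norml; lra.
Unshelve. all: by end_near. Qed.

(** A product rule. The quotient of the test function is integrated against [rho (h + s)], not
    [rho s]; so its convergence must be uniform in [x], and weak continuity then moves the limit [g]
    back to [rho s]. *)
Lemma moving_derive (phi : R -> S -> R) (g : S -> R) (s D : R) :
  (forall r, continuous (phi r)) -> continuous g ->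
  (forall e, 0 < e -> \forall h \near 0^', forall x,
     `|h^-1 * (phi (h + s) x - phi s x) - g x| <= e) ->
  is_derive s 1 (fun r => \int[rho r]_x phi s x) D ->
  is_derive s 1 (fun r => \int[rho r]_x phi r x) (\int[rho s]_x g x + D).
Proof.
move=> cphi cg unif /is_derive_cvgP dJ; apply/is_derive_cvgP.
have cq h : continuous (fun x => h^-1 * (phi (h + s) x - phi s x)).
  move=> x; exact: (cvgM (cvg_cst h^-1) (cvgB (@cphi (h + s) x) (@cphi s x))).
have e1 : (fun h => h^-1 * (\int[rho (h + s)]_x phi (h + s) x - \int[rho s]_x phi s x)) =
   (fun h => \int[rho (h + s)]_x (h^-1 * (phi (h + s) x - phi s x)) +
     h^-1 * (\int[rho (h + s)]_x phi s x - \int[rho s]_x phi s x)).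
  apply/funext => h; rewrite RintegralZl//; last first.
    apply: (@continuous_sphere_integrable R d (fun x => phi (h + s) x - phi s x)) => x.
    by apply: continuousB; exact: cphi.
  rewrite RintegralB//; try exact: continuous_sphere_integrable.
  by ring.
rewrite e1; apply: cvgD => //.
apply/cvgrPdist_le => e e0; have e2 : 0 < e / 2 by rewrite divr_gt0.
have J : \forall h \near 0^', `|\int[rho s]_x g x - \int[rho (h + s)]_x g x| <= e / 2.
  apply: cvg_within.
  have : (fun h => \int[rho (h + s)]_x g x) @ 0 --> \int[rho s]_x g x.
    have c1 : (fun h : R => h + s) @ 0 --> s.
      by rewrite -[X in _ --> X]add0r; apply: cvgD; [exact: cvg_id|exact: cvg_cst].
    exact: (cvg_comp (fun h => h + s) (fun r => \int[rho r]_x g x) c1 (@rho_cont _ cg s)).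
  by move/cvgrPdist_le => /(_ _ e2).
near=> h.
have h1 : `|\int[rho s]_x g x - \int[rho (h + s)]_x g x| <= e / 2 by near: h.
have h2 : `|\int[rho (h + s)]_x (h^-1 * (phi (h + s) x - phi s x)) -
    \int[rho (h + s)]_x g x| <= e / 2.
  have [M1 b1] := continuous_sphere_bounded (cq h).
  have [M2 b2] := continuous_sphere_bounded cg.
  apply: (@Rintegral_dist_le _ _ _ _ _ _ M1 M2) => //.
  - exact: continuous_sphere_measurable.
  - exact: continuous_sphere_measurable.
  - by near: h; exact: unif.
by move: h1 h2; rewrite !ler_norml; lra.
Unshelve. all: by end_near. Qed.

(* The mean value theorem turns joint continuity of the time derivative into
   convergence of the difference quotients, uniformly over the compact sphere. *)
Lemma quotient_uniform (phi g : R -> S -> R) (s : R) : 0 < s ->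
  (forall (x : S) (r : R), 0 < r -> is_derive r 1 (fun u => phi u x) (g r x)) ->
  (forall x, {for (s, x), continuous (fun p : R * S => g p.1 p.2)}) ->
  forall e, 0 < e -> \forall h \near 0^', forall x,
     `|h^-1 * (phi (h + s) x - phi s x) - g s x| <= e.
Proof.
move=> s0 dphi jc e e0.
apply: (@near_sphere R d R (nbhs 0^')
  (fun h x => `|h^-1 * (phi (h + s) x - phi s x) - g s x| <= e)) => x.
have e2 : 0 < e / 2 by rewrite divr_gt0.
have [[U V] /= [Us Vx] UV] : \forall p \near (s, x), `|g s x - g p.1 p.2| < e / 2.
  by move/cvgrPdist_lt: (jc x) => /(_ _ e2).
have [r /= r0 rU] : exists2 r, 0 < r & forall u, `|s - u| < r -> 0 < u /\ U u.
  have : nbhs s ([set u | 0 < u] `&` U).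
    by apply: filterI => //; exact: lt_nbhsr.
  by move=> /nbhs_normP[r r0 rU]; exists r => // u hu; exact: rU.
exists (V, [set h : R | `|h| < r /\ h != 0]).
  split => //=; near=> h; split; last by near: h; exact: nbhs_dnbhs_neq.
  by near: h; exact: dnbhs0_lt.
move=> [x' h] /= [Vx' [hr h0]].
have dd (u : R) : `|s - u| < r -> is_derive u 1 (fun u => phi u x') (g u x').
  by move=> /rU[u0 _]; exact: dphi.
have cc a b : (forall u, a <= u <= b -> `|s - u| < r) ->
    {within `[a, b], continuous (fun u => phi u x')}.
  move=> hab; apply: continuous_in_subspaceT => u; rewrite inE /= in_itv /= => hu.
  exact: is_derive_continuous (dd u (hab u hu)).
have [c cr ->] : exists2 c, `|s - c| < r & h^-1 * (phi (h + s) x' - phi s x') = g c x'.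
  have [hp|hn] := ltP 0 h.
    have inr u : s <= u <= h + s -> `|s - u| < r.
      by move: hr; rewrite !ltr_norml; lra.
    have [|||c] := @MVT R (fun u => phi u x') (fun u => g u x') s (h + s).
    - by rewrite ltrDr.
    - by move=> u; rewrite in_itv /= => hu; apply: dd; apply: inr; move: hu; lra.
    - exact: cc.
    rewrite in_itv /= => hc ->; exists c; first by apply: inr; move: hc; lra.
    by rewrite addrK mulrC mulfK.
  have hn' : h < 0 by rewrite lt_neqAle h0.
  have inr u : h + s <= u <= s -> `|s - u| < r.
    by move: hr; rewrite !ltr_norml; lra.
  have [|||c] := @MVT R (fun u => phi u x') (fun u => g u x') (h + s) s.
  - by rewrite gtrDr.
  - by move=> u; rewrite in_itv /= => hu; apply: dd; apply: inr; move: hu; lra.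
  - exact: cc.
  rewrite in_itv /= => hc e3; exists c; first by apply: inr; move: hc; lra.
  rewrite -opprB e3 (_ : s - (h + s) = - h); last by ring.
  by field.
have [_ Uc] := rU c cr; have [_ Us'] : 0 < s /\ U s by apply: rU; rewrite subrr normr0.
have h1 := UV (c, x') (conj Uc Vx'); have h2 := UV (s, x') (conj Us' Vx').
by move: h1 h2; rewrite /= !ltr_norml ler_norml; lra.
Unshelve. all: by end_near. Qed.

End moving_test_function.

Section transport.
Context (R : realType) (d : nat).
Notation V := 'cV[R]_d.+1.
Notation S := (sphere R d).
Variables (rho : R -> probability S R) (A : R -> 'M[R]_d.+1).
Hypothesis Ac : forall i j, continuous (fun t => A t i j).
Hypothesis rho_cont : forall f : S -> R, continuous f ->
  continuous (fun s => \int[rho s]_x f x).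
Hypothesis rho_eq : forall psi, C1_sphere psi -> forall t : R, 0 < t ->
  is_derive t 1 (fun s => \int[rho s]_x psi x)
    (\int[rho t]_x dotv (gradient (hext psi) (spval x)) (A t *m spval x)).
Variables G H : R -> 'M[R]_d.+1.
Hypothesis GHc : forall i j, continuous (fun t => G t i j) /\ continuous (fun t => H t i j).
Hypothesis GH0 : forall t, t <= 0 -> G t = 1%:M /\ H t = 1%:M.
Hypothesis dH : forall t : R, 0 < t -> forall i j,
  is_derive t 1 (fun s => H s i j) (- (H t *m A t) i j).
Hypothesis HG : forall t, H t *m G t = 1%:M.

Lemma transport_integral psi t : C1_sphere psi -> 0 <= t ->
  \int[rho t]_x psi x = \int[rho 0]_x psi (normalize (G t *m spval x)).
Proof.
move=> hpsi; rewrite le_eqVlt => /predU1P[<-|t0].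
  have [-> _] := GH0 (lexx 0).
  by apply: eq_Rintegral => x _; rewrite mul1mx normalize_spval.
pose N s := G t *m H s.
have uN s : N s \in unitmx.
  by rewrite unitmx_mul (mulmx1_unit (HG t)).2 (mulmx1_unit (HG s)).1.
have N0 s (x : S) : N s *m spval x != 0.
  exact: unitmx_mul_neq0 (uN s) (spval_neq0 x).
pose phi s (x : S) := psi (normalize (N s *m spval x)).
(* This is the time derivative of [phi]: with the final time [t] fixed, [H' = - H A] gives
   [N' = - N A]. *)
pose g s (x : S) := dotv (gradient (hext psi) (N s *m spval x)) (- (N s *m A s) *m spval x).
have C1phi s : C1_sphere (phi s) := C1grad_C1_sphere (C1grad_pullback (uN s) hpsi).
have Ncont : continuous N.
  move=> s; apply: (@cvg_mulmx _ _ _ (nbhs s)); first exact: cvg_cst.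
  by apply: cvg_mx_entries => i j; exact: (GHc i j).2.
have Acont : continuous A by move=> s; apply: cvg_mx_entries => i j; exact: Ac.
have fstc (s : R) (x : S) : (fun p : R * S => p.1) @ (s, x) --> s by exact: cvg_fst.
have sndc (s : R) (x : S) : (fun p : R * S => spval p.2) @ (s, x) --> spval x.
  exact: (cvg_comp (fun p : R * S => p.2) (@spval R d) cvg_snd (@spval_continuous R d x)).
have Nc1 (s : R) (x : S) : (fun p : R * S => N p.1) @ (s, x) --> N s.
  exact: (cvg_comp (fun p : R * S => p.1) N (fstc s x) (Ncont s)).
have Ac1 (s : R) (x : S) : (fun p : R * S => A p.1) @ (s, x) --> A s.
  exact: (cvg_comp (fun p : R * S => p.1) A (fstc s x) (Acont s)).
have Nxc (s : R) (x : S) : (fun p : R * S => N p.1 *m spval p.2) @ (s, x) --> N s *m spval x.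
  exact: cvg_mulmx (Nc1 s x) (sndc s x).
have jphi s x : {for (s, x), continuous (fun p : R * S => phi p.1 p.2)}.
  have [df _] := hpsi _ (N0 s x).
  have cf : {for N s *m spval x, continuous (hext psi)} by exact: differentiable_continuous df.
  exact: (cvg_comp (fun p : R * S => N p.1 *m spval p.2) (hext psi) (Nxc s x) cf).
have jg s x : {for (s, x), continuous (fun p : R * S => g p.1 p.2)}.
  have [_ cg] := hpsi _ (N0 s x).
  apply: (@cvg_dotv _ _ _ (nbhs (s, x))).
    exact: (cvg_comp (fun p : R * S => N p.1 *m spval p.2) (gradient (hext psi)) (Nxc s x) cg).
  exact: cvg_mulmx (cvgN (cvg_mulmx (Nc1 s x) (Ac1 s x))) (sndc s x).
have cg s : continuous (g s).
  move=> x; have c2 : (fun y : S => (s, y)) @ x --> (s, x).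
    move=> U [[P Q] /= [Ps Qx] PQU]; apply: filterS Qx => y Qy; apply: PQU; split => //.
    exact: nbhs_singleton Ps.
  exact: (cvg_comp (fun y : S => (s, y)) (fun p : R * S => g p.1 p.2) c2 (jg s x)).
have dphi (x : S) (r : R) : 0 < r -> is_derive r 1 (fun u => phi u x) (g r x).
  move=> r0; apply: (@is_derive_curve R d psi (fun u => N u *m spval x)) => // i.
  have -> : (fun u => (N u *m spval x) i 0) =
      (fun u => \sum_k \sum_l G t i l * H u l k * spval x k 0).
    apply/funext => u; rewrite mxE; apply: eq_bigr => k _.
    by rewrite mxE mulr_suml.
  apply: (@is_derive_eq _ _ _ _ _ _ _
    (\sum_k \sum_l G t i l * (- (H r *m A r) l k) * spval x k 0)).
    apply: is_derive_bigsum => k; apply: is_derive_bigsum => l.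
    have := is_derive_scale (spval x k 0) (is_derive_scale (G t i l) (dH r0 l k)).
    have -> : (fun u => spval x k 0 * (G t i l * H u l k)) =
       (fun u => G t i l * H u l k * spval x k 0) by apply/funext => u; ring.
    by move=> h; apply: is_derive_eq h _; ring.
  rewrite mulNmx [RHS]mxE [X in - X]mxE -sumrN; apply: eq_bigr => k _.
  rewrite /N -mulmxA mxE mulr_suml -sumrN; apply: eq_bigr => l _; ring.
have cphi s : continuous (phi s) := C1_sphere_continuous (C1phi s).
have dE (s : R) : 0 < s -> is_derive s 1 (fun r => \int[rho r]_x phi r x) 0.
  move=> s0.
  have h := moving_derive rho_cont cphi (cg s)
    (quotient_uniform s0 dphi (jg s)) (rho_eq (C1phi s) s0).
  apply: is_derive_eq h _.
  (* The extension of [phi s] has gradient [N^T *m gradient (hext psi) (N x)]; moving [N^T] across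
     the product leaves [N A x], so the transport term cancels the time derivative [g]. *)
  have -> : \int[rho s]_x dotv (gradient (hext (phi s)) (spval x)) (A s *m spval x) =
      \int[rho s]_x (-1 * g s x).
    apply: eq_Rintegral => x _.
    rewrite (C1grad_gradient (C1grad_pullback (uN s) hpsi) (spval_neq0 x)).
    rewrite dotv_mulmx trmxK /g mulNmx (dotvC _ (- _)) dotvNl mulN1r opprK mulmxA dotvC.
    by [].
  rewrite RintegralZl//; first by ring.
  exact: continuous_sphere_integrable.
have cE : continuous (fun r => \int[rho r]_x phi r x).
  by move=> s; exact: (moving_continuous rho_cont cphi (jphi s)).
have [c _] := @MVT R _ (fun=> 0) 0 t t0
  (fun x h => dE x ltac:(by move: h; rewrite in_itv => /andP[]))
  (continuous_subspaceT cE).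
rewrite mul0r => /eqP; rewrite subr_eq0 => /eqP e.
(* The conserved integral is read at both ends: at [s = t] the test function is [psi], at [s = 0] it
   is [psi] composed with the flow up to [t]. *)
have Nt : N t = 1%:M by exact: mulmx1C (HG t).
have N0' : N 0 = G t by rewrite /N (GH0 (lexx 0)).2 mulmx1.
have -> : \int[rho t]_x psi x = \int[rho t]_x phi t x.
  by apply: eq_Rintegral => x _; rewrite /phi Nt mul1mx normalize_spval.
by rewrite e; apply: eq_Rintegral => x _; rewrite /phi N0'.
Qed.

End transport.

(** * Differentiable functions determine measures *)

Section smooth_tools.
Context (R : realType).

(** A [C^1] function positive exactly on the positive half-line; the square makes its derivative
    continuous at 0. *)
Definition pos2 (r : R) : R := if 0 < r then r ^+ 2 else 0.
Definition dpos2 (r : R) : R := if 0 < r then 2 * r else 0.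

Lemma is_derive_pos2 (r : R) : is_derive r 1 pos2 (dpos2 r).
Proof.
apply/is_derive_cvgP; rewrite /dpos2; have [r0|r0] := ltP 0 r.
  have : (fun h => 2 * r + h) @ 0^' --> 2 * r + (0 : R).
    by apply: cvgD; [exact: cvg_cst|apply: cvg_within; exact: cvg_id].
  rewrite addr0 => h1.
  have e : \forall h \near 0^', 2 * r + h = h^-1 * (pos2 (h + r) - pos2 r).
    near=> h.
    have h0 : h != 0 by near: h; exact: nbhs_dnbhs_neq.
    have hr : `|h| < r by near: h; exact: dnbhs0_lt.
    have hr0 : 0 < h + r by move: hr; rewrite ltr_norml; lra.
    by rewrite /pos2 r0 hr0; field.
  exact: (cvg_trans (near_eq_cvg e) h1).
apply/cvgrPdist_le => e e0; near=> h.
have h0 : h != 0 by near: h; exact: nbhs_dnbhs_neq.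
have he : `|h| <= e by near: h; exact: dnbhs0_le.
rewrite sub0r normrN /pos2 [X in _ - X]ifF; last by rewrite ltNge r0.
rewrite subr0; case: ifPn => hr; last by rewrite mulr0 normr0 ltW.
have hp : 0 < h by lra.
have e1 : h^-1 * (h + r) ^+ 2 <= h.
  by rewrite mulrC ler_pdivrMr// -expr2 ler_sqr ?nnegrE ?(ltW hr) ?(ltW hp)//; lra.
have e2 : 0 <= h^-1 * (h + r) ^+ 2.
  by apply: mulr_ge0; [rewrite invr_ge0 ltW|exact: sqr_ge0].
rewrite (ger0_norm e2).
by apply: le_trans e1 _; move: he; rewrite gtr0_norm.
Unshelve. all: by end_near. Qed.

Lemma dpos2_continuous : continuous dpos2.
Proof.
have -> : dpos2 = (fun r => r + `|r|).
  apply/funext => r; rewrite /dpos2; case: ltP => r0; first by rewrite gtr0_norm//; ring.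
  by rewrite ler0_norm// subrr.
move=> r; apply: (@cvgD _ _ _ (nbhs r)); first exact: cvg_id.
by apply: (@cvg_norm _ _ _ (nbhs r)); exact: cvg_id.
Qed.

Lemma pos2_ge0 r : 0 <= pos2 r.
Proof. by rewrite /pos2; case: ifP => // _; exact: sqr_ge0. Qed.

End smooth_tools.

Section determination.
Context (R : realType) (d : nat).
Notation V := 'cV[R]_d.+1.
Notation S := (sphere R d).

Lemma C1grad_dotvv : exists G, C1grad (fun y : V => dotv y y) G.
Proof.
exists (fun y => \sum_i ((dotv (delta_mx i 0) y) *: (delta_mx i 0 : V) +
  dotv (delta_mx i 0) y *: (delta_mx i 0 : V))).
have -> : (fun y : V => dotv y y) =
    (fun y => \sum_i dotv (delta_mx i 0) y * dotv (delta_mx i 0) y).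
  apply/funext => y; apply: eq_bigr => i _.
  have -> // : dotv (delta_mx i 0) y = y i 0.
  rewrite /dotv (bigD1 i)//= big1 ?addr0 ?mxE ?eqxx ?mul1r// => k ki.
  by rewrite mxE (negPf ki) mul0r.
apply: C1grad_sum => i; apply: C1grad_mul; exact: C1grad_dotv.
Qed.

(** On the sphere this function is positive exactly on the cap [c < dotv q x]. The factor [1 / |y|]
    makes it 0-homogeneous, hence equal off the origin to the extension of its restriction. *)
Lemma C1grad_cap (q : V) (c : R) : exists G,
  C1grad (fun y : V => pos2 ((enorm y)^-1 * dotv q y - c)) G.
Proof.
have [G1 h1] := C1grad_dotvv.
pose dth (r : R) := - (Num.sqrt r) ^- 2 * (2 * Num.sqrt r)^-1.
have pos (y : V) : y != 0 -> 0 < dotv y y by move=> y0; rewrite dotvv exprn_gt0// enorm_gt0.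
have h2 : C1grad (fun y : V => (enorm y)^-1) (fun y => dth (dotv y y) *: G1 y).
  apply: (C1grad_comp (theta := fun r => (Num.sqrt r)^-1) _ _ h1) => y y0.
    have s0 : Num.sqrt (dotv y y) != 0 by rewrite sqrtr_eq0 -ltNge pos.
    have := @is_deriveV R Num.sqrt _ _ _ s0 (is_derive1_sqrt (pos y y0)).
    exact.
  have sc := @sqrt_continuous R (dotv y y).
  have s0 : Num.sqrt (dotv y y) != 0 by rewrite sqrtr_eq0 -ltNge pos.
  apply: cvgM; first apply: cvgN; apply: cvgV.
  - by rewrite expf_eq0.
  - exact: (cvgM sc sc).
  - by rewrite mulf_neq0.
  - by apply: cvgM => //; exact: cvg_cst.
have h3 := C1grad_add (C1grad_mul h2 (C1grad_dotv q)) (@C1grad_cst R d (- c)).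
have h4 := C1grad_comp (fun y _ => is_derive_pos2 _) (fun y _ => @dpos2_continuous R _) h3.
by eexists; exact: h4.
Qed.

(** A smoothed indicator of the union of the caps: [m] is both the number of caps taken into account
    and the sharpness, so a single limit exhausts countably many caps. *)
Definition cap_bump (q : nat -> V) (c : nat -> R) (m : nat) (x : S) : R :=
  1 - expR (- (m%:R * \sum_(j <- iota 0 m) pos2 (dotv (q j) (spval x) - c j))).

Lemma cap_bump_C1 q c m : C1_sphere (cap_bump q c m).
Proof.
have hG j := cid (C1grad_cap (q j) (c j)).
have h1 := C1grad_sum (iota 0 m) (fun j => projT2 (hG j)).
have h2 := C1grad_mul (@C1grad_cst R d (- m%:R)) h1.
have h3 := C1grad_comp (fun y _ => is_derive_expR _) (fun y _ => @continuous_expR R _) h2.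
have h4 := C1grad_add (@C1grad_cst R d 1) (C1grad_mul (@C1grad_cst R d (-1)) h3).
apply: (C1grad_C1_sphere (C1grad_eq _ h4)) => y y0.
rewrite /hext /cap_bump mulN1r mulNr; congr (1 - expR (- (_ * _))).
by apply: eq_bigr => j _; rewrite normalizeE// dotvZr.
Qed.

Lemma cap_bump_bounded q c m x : `|cap_bump q c m x| <= 1.
Proof.
have s0 : 0 <= m%:R * \sum_(j <- iota 0 m) pos2 (dotv (q j) (spval x) - c j).
  by rewrite mulr_ge0// sumr_ge0// => j _; exact: pos2_ge0.
have e0 := expR_ge0 (- (m%:R * \sum_(j <- iota 0 m) pos2 (dotv (q j) (spval x) - c j))).
have e1 : expR (- (m%:R * \sum_(j <- iota 0 m) pos2 (dotv (q j) (spval x) - c j))) <= 1.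
  by rewrite -[leRHS]expR0 ler_expR oppr_le0.
rewrite /cap_bump ger0_norm; lra.
Qed.

Lemma cap_bump_cvg q c x (U : set S) :
  (U x <-> exists j, c j < dotv (q j) (spval x)) ->
  (fun m => cap_bump q c m x) @ \oo --> (\1_U x : R).
Proof.
move=> hU; rewrite indicE; have [|] := boolP (x \in U).
  rewrite inE => /hU[j hj].
  (* As soon as [m > j] the sum contains [p], so the bump differs from 1 by at most
     [expR (- p) ^+ m]. *)
  pose p := pos2 (dotv (q j) (spval x) - c j).
  have p0 : 0 < p by rewrite /p /pos2 subr_gt0 hj exprn_gt0// subr_gt0.
  have ep : `|expR (- p)| < 1.
    by rewrite ger0_norm ?expR_ge0// -expR0 ltr_expR oppr_lt0.
  have lim : (fun m => 1 - expR (- p) ^+ m) @ \oo --> 1 - (0 : R).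
    by apply: cvgB; [exact: cvg_cst|exact: cvg_expr].
  rewrite subr0 in lim.
  apply: (squeeze_cvgr _ lim (cvg_cst (1 : R))).
  near=> m; apply/andP; split; last first.
    by rewrite /cap_bump gerBl expR_ge0.
  rewrite /cap_bump lerD2l lerN2 -expRM_natl ler_expR mulrN lerN2 ler_wpM2l//.
  rewrite (bigD1_seq j)/=; last 2 first.
  - by rewrite mem_iota add0n /=; near: m; exact: nbhs_infty_gt.
  - exact: iota_uniq.
  by rewrite lerDl sumr_ge0// => k _; exact: pos2_ge0.
move=> xU; have xU' : ~ U x by move=> Ux; move/negP: xU; apply; exact: mem_set.
have -> : (fun m => cap_bump q c m x) = (fun=> 0); last exact: cvg_cst.
apply/funext => m; rewrite /cap_bump big1 ?mulr0 ?oppr0 ?expR0 ?subrr// => j _.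
rewrite /pos2 ifF//; apply/negbTE; rewrite -leNgt subr_le0 leNgt; apply/negP => hj.
by apply: xU'; apply/hU; exists j.
Unshelve. all: by end_near. Qed.

Lemma rat_near (a : R) (e : R) : 0 < e -> exists q : rat, `|a - ratr q| < e.
Proof.
move=> e0; have [q] := @rat_in_itvoo R (a - e) (a + e) ltac:(lra).
by rewrite in_itv /= => /andP[h1 h2]; exists q; rewrite ltr_norml; lra.
Qed.

(** On the sphere [|y - Q|^2 = 1 + |Q|^2 - 2 Q.y], so a ball about any vector [Q] cuts out a cap.
    The caps with rational data that lie inside [U] are countably many and cover it. *)
Lemma open_sphere_caps (U : set S) : open U -> exists (q : nat -> V) (c : nat -> R),
  forall x, U x <-> exists j, c j < dotv (q j) (spval x).
Proof.
move=> oU.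
have dot0v (v : V) : dotv 0 v = 0 by apply: big1 => i _; rewrite mxE mul0r.
pose T := ('cV[rat]_d.+1 * rat)%type.
pose good (t : T) := `[< forall x : S,
  ratr t.2 < dotv (map_mx (@ratr R) t.1) (spval x) -> U x >].
(* Indices that are of no use are sent to the empty cap [0 < dotv 0 x]. *)
pose f (j : nat) : V * R := match (unpickle j : option T) with
  | Some t => if good t then (map_mx (@ratr R) t.1, ratr t.2) else (0, 0)
  | None => (0, 0)
  end.
exists (fun j => (f j).1), (fun j => (f j).2) => x; split; last first.
  move=> [j]; rewrite /f; case: unpickle => [t|] /=; last first.
    by rewrite dot0v ltxx.
  case: ifPn => /= [/asboolP h|_]; first exact: h.
  by rewrite dot0v ltxx.
move=> Ux; have [W oW UW] := sphere_openP oU.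
have : nbhs (spval x) W by apply: open_nbhs_nbhs; split => //; move: Ux; rewrite UW.
move=> /nbhs_normP [r /= r0 rW].
have [q hq] : exists q : 'cV[rat]_d.+1, enorm (spval x - map_mx (@ratr R) q) < r / 2.
  have e0 : 0 < r / 2 / d.+1%:R by rewrite !divr_gt0.
  have h i := cid (rat_near (spval x i 0) e0).
  exists (\col_i projT1 (h i)); apply: le_lt_trans (enorm_sum_norm _) _.
  apply: (@lt_le_trans _ _ (\sum_(i < d.+1) (r / 2 / d.+1%:R))).
    apply: ltr_sum => [|i _]; first by apply/hasP; exists ord0; rewrite ?mem_index_enum.
    by rewrite !mxE; exact: projT2 (h i).
  by rewrite sumr_const card_ord -[leLHS]mulr_natr divfK// pnatr_eq0.
set Q := map_mx _ q in hq.
have sq (y : S) : enorm (spval y - Q) ^+ 2 = 1 + dotv Q Q - 2 * dotv Q (spval y).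
  rewrite -dotvv dotvBl !dotvBr dotv_spval (dotvC _ Q); ring.
have lt1 : enorm (spval x - Q) ^+ 2 < (r / 2) ^+ 2.
  by rewrite ltr_sqr ?nnegrE ?enorm_ge0// divr_ge0// ltW.
(* The lower end is the threshold of the ball of radius [r / 2] about [Q]: above it the cap stays in
   that ball, below [Q.x] it still contains [x]. *)
have [c hc] := @rat_in_itvoo R ((1 + dotv Q Q - (r / 2) ^+ 2) / 2) (dotv Q (spval x))
  ltac:(move: lt1; rewrite sq; lra).
move: hc; rewrite in_itv /= => /andP[hc1 hc2].
have gqc : good (q, c).
  apply/asboolP => y /= hy; rewrite UW; apply: rW => /=.
  apply: le_lt_trans (normr_enorm _) _.
  have : enorm (spval y - Q) < r / 2.
    rewrite -ltr_sqr ?nnegrE ?enorm_ge0 ?sq ?divr_ge0 ?(ltW r0)//.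
    by move: hy hc1; rewrite -/Q; lra.
  have := enormB (spval x - Q) (spval y - Q).
  rewrite opprB addrA subrK => h1 h2; move: hq; lra.
by exists (pickle (q, c)); rewrite /f pickleK gqc.
Qed.

(** Open sets form a generating class stable under intersection, so agreement there suffices; on an
    open set it follows by dominated convergence from bumps bounded by 1. *)
Lemma C1_sphere_determines (mu nu : probability S R) :
  (forall psi, C1_sphere psi -> \int[mu]_x psi x = \int[nu]_x psi x) ->
  forall B, measurable B -> mu B = nu B.
Proof.
move=> h B mB; apply: (measure_unique (@open S) (fun=> setT)) => //.
- exact: openI.
- by move=> _; exact: openT.
- by rewrite bigcup_const.
- move=> U oU; have [q [c hU]] := open_sphere_caps oU.
  have mU := open_sphere_measurable oU.
  have lim (P : probability S R) :
      (fun m => (\int[P]_x (cap_bump q c m x)%:E)%E) @ \oo --> P U.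
    have -> : P U = (\int[P]_x (\1_U x)%:E)%E by rewrite integral_indic// setIT.
    apply: (@dominated_cvg _ _ _ P setT measurableT _ _ (fun=> 1%E)).
    - move=> m; apply/measurable_EFinP; apply: continuous_sphere_measurable.
      exact: C1_sphere_continuous (cap_bump_C1 q c m).
    - move=> x _; apply: cvg_EFin; first by apply: nearW.
      exact: cap_bump_cvg.
    - by [].
    - apply: (@bounded_integrable _ _ _ P (fun=> 1) 1) => //.
      by move=> x; rewrite normr1.
    - by move=> m x _; rewrite /= lee_fin cap_bump_bounded.
  have e m : (\int[mu]_x (cap_bump q c m x)%:E = \int[nu]_x (cap_bump q c m x)%:E)%E.
    have mc := continuous_sphere_measurable (C1_sphere_continuous (cap_bump_C1 q c m)).
    rewrite (Rintegral_EFin mu mc (cap_bump_bounded q c m)).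
    rewrite (Rintegral_EFin nu mc (cap_bump_bounded q c m)).
    by rewrite h//; exact: cap_bump_C1.
  have := lim mu; under eq_fun do rewrite e.
  by move=> l1; exact: (cvg_unique _ l1 (lim nu)).
- by move=> _; exact: fin_num_fun_lty.
Qed.

End determination.

(** * Stability of the characteristics *)

Section trajectory_comparison.
Context (R : realType) (m : nat).
Notation V := 'cV[R]_m.
Implicit Types (A B : 'M[R]_m) (x y u v : V).

(* The left-hand side is half the derivative of [|x - y|^2] when [x] and [y] move
   on the sphere with velocities [(1 - x x^T) A x] and [(1 - y y^T) B y]. *)
Lemma angle_derivative_bound A B x y (C : R) : enorm x = 1 -> enorm y = 1 ->
  opnorm B <= C ->
  - (dotv (A *m x) y + dotv x (B *m y)
     - dotv x y * (dotv x (A *m x) + dotv y (B *m y)))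
  <= enorm (x - y) * opnorm (A - B) + 2 * C * enorm (x - y) ^+ 2.
Proof.
move=> nx ny BC; set c := dotv x y; set e := enorm (x - y).
have xx : dotv x x = 1 by rewrite dotvv nx expr1n.
have yy : dotv y y = 1 by rewrite dotvv ny expr1n.
have e2 : e ^+ 2 = 2 - 2 * c.
  by rewrite -dotvv dotvBl !dotvBr xx yy (dotvC y) -/c; ring.
have e0 : 0 <= e by exact: enorm_ge0.
have c1 : c <= 1 by have := ler_dotv x y; rewrite nx ny mul1r.
have c1' : -1 <= c.
  by have := cauchy_schwarz x y; rewrite nx ny mul1r ler_norml => /andP[].
(* The three terms isolate the causes of separation: different matrices, different points under the
   same matrix, and the difference of the projections. The last carries [1 - c = e ^ 2 / 2] and is
   thus quadratic in [e] as well. *)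
have -> : dotv (A *m x) y + dotv x (B *m y) - c * (dotv x (A *m x) + dotv y (B *m y))
    = dotv (y - c *: x) ((A - B) *m x) + dotv (y - c *: x) (B *m (x - y))
      + (1 - c) * dotv (x + y) (B *m y).
  rewrite mulmxBl mulmxBr !dotvBr !dotvBl !dotvDl !dotvZl (dotvC (A *m x)); ring.
(* This is the part of [y] orthogonal to [x]; its squared norm [(1 - c) (1 + c)] is at most
   [2 (1 - c)]. *)
have nw : enorm (y - c *: x) <= e.
  rewrite -ler_sqr ?nnegrE ?enorm_ge0// e2 -dotvv dotvBl !dotvBr !dotvZl !dotvZr yy xx.
  by rewrite (dotvC y x) -/c; nra.
have C0 : 0 <= C by exact: le_trans (opnorm_ge0 _) BC.
have h1 : - dotv (y - c *: x) ((A - B) *m x) <= e * opnorm (A - B).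
  apply: le_trans (ler_norm _) _; rewrite normrN.
  apply: le_trans (dotv_opnorm _ _ _) _; rewrite nx mulr1 mulrC.
  by rewrite ler_wpM2r// opnorm_ge0.
have h2 : - dotv (y - c *: x) (B *m (x - y)) <= C * e ^+ 2.
  apply: le_trans (ler_norm _) _; rewrite normrN.
  apply: le_trans (dotv_opnorm _ _ _) _; rewrite -/e expr2.
  by rewrite ler_pM ?opnorm_ge0 ?mulr_ge0 ?enorm_ge0// ler_wpM2r.
have h3 : - dotv (x + y) (B *m y) <= 2 * C.
  apply: le_trans (ler_norm _) _; rewrite normrN.
  apply: le_trans (dotv_opnorm _ _ _) _; rewrite ny mulr1 mulrC.
  apply: ler_pM; rewrite ?enorm_ge0 ?opnorm_ge0//.
  by have := enormD x y; rewrite nx ny.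
have h4 : - ((1 - c) * dotv (x + y) (B *m y)) <= (1 - c) * (2 * C).
  by rewrite -mulrN ler_wpM2l// subr_ge0.
by move: h1 h2 h4; rewrite e2; lra.
Qed.

Lemma is_derive_dotv (u v : R -> V) (u' v' : V) (t : R) :
  (forall i, is_derive t 1 (fun s => u s i 0) (u' i 0)) ->
  (forall i, is_derive t 1 (fun s => v s i 0) (v' i 0)) ->
  is_derive t 1 (fun s => dotv (u s) (v s)) (dotv u' (v t) + dotv (u t) v').
Proof.
move=> hu hv.
have h := is_derive_bigsum (index_enum 'I_m) (fun i => is_derive_mul (hu i) (hv i)).
by rewrite big_split in h.
Qed.

Lemma is_derive_enorm (u : R -> V) (u' : V) (t : R) : u t != 0 ->
  (forall i, is_derive t 1 (fun s => u s i 0) (u' i 0)) ->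
  is_derive t 1 (fun s => enorm (u s)) (dotv (u t) u' / enorm (u t)).
Proof.
move=> u0 hu; have pos : 0 < dotv (u t) (u t) by rewrite dotvv exprn_gt0// enorm_gt0.
have h := is_derive_chain (is_derive1_sqrt pos) (is_derive_dotv hu hu).
apply: is_derive_eq h _; rewrite (dotvC u') -enormE.
by field; rewrite enorm_eq0.
Qed.

Variables (A B : R -> 'M[R]_m) (u v : R -> V) (C M lam T : R).
Hypothesis uc : continuous u.
Hypothesis vc : continuous v.
Hypothesis du : forall t : R, 0 < t -> forall i,
  is_derive t 1 (fun s => u s i 0) ((A t *m u t) i 0).
Hypothesis dv : forall t : R, 0 < t -> forall i,
  is_derive t 1 (fun s => v s i 0) ((B t *m v t) i 0).
Hypothesis u0 : forall t, u t != 0.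
Hypothesis v0 : forall t, v t != 0.
Hypothesis lam0 : 0 < lam.
Hypothesis BC : forall t, opnorm (B t) <= C.
Hypothesis AB : forall t, 0 < t <= T ->
  opnorm (A t - B t) <= M * expR ((3 * C + lam) * t).

Let x t := (enorm (u t))^-1 *: u t.
Let y t := (enorm (v t))^-1 *: v t.
Let e t := enorm (x t - y t).
Let c t := dotv (u t) (v t) / (enorm (u t) * enorm (v t)).

Let nu0 t : enorm (u t) != 0. Proof. by rewrite enorm_eq0. Qed.
Let nv0 t : enorm (v t) != 0. Proof. by rewrite enorm_eq0. Qed.
Let nx t : enorm (x t) = 1.
Proof. by rewrite enormZ ger0_norm ?invr_ge0 ?enorm_ge0// mulVf. Qed.
Let ny t : enorm (y t) = 1.
Proof. by rewrite enormZ ger0_norm ?invr_ge0 ?enorm_ge0// mulVf. Qed.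

Let cE t : c t = dotv (x t) (y t).
Proof. by rewrite dotvZl dotvZr /c invfM; ring. Qed.

Let e2 t : e t ^+ 2 = 2 - 2 * c t.
Proof.
rewrite -dotvv dotvBl !dotvBr !dotvv nx ny (dotvC (y t)) -cE; ring.
Qed.

Let dc (t : R) : 0 < t -> is_derive t 1 c
  (dotv (A t *m x t) (y t) + dotv (x t) (B t *m y t)
     - dotv (x t) (y t) * (dotv (x t) (A t *m x t) + dotv (y t) (B t *m y t))).
Proof.
move=> t0.
have h1 := is_derive_dotv (du t0) (dv t0).
have h2 := is_derive_mul (is_derive_enorm (u0 t) (du t0)) (is_derive_enorm (v0 t) (dv t0)).
have n0 : enorm (u t) * enorm (v t) != 0 by rewrite mulf_neq0.
have h3 := @is_deriveV R (fun s => enorm (u s) * enorm (v s)) t _ _ n0 h2.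
apply: is_derive_eq (is_derive_mul h1 h3) _.
rewrite /x /y /GRing.scale /= -!scalemxAr !dotvZl !dotvZr (dotvC (A t *m u t)).
by field; rewrite nu0 nv0.
Qed.

Let ccont : continuous c.
Proof.
move=> t.
have n0 : enorm (u t) * enorm (v t) != 0 by rewrite mulf_neq0.
have FF : Filter (nbhs t) by exact: nbhs_filter.
have h1 := @cvg_dotv R m _ (nbhs t) FF u v _ _ (@uc t) (@vc t).
have h2 := @cvg_enorm R m _ (nbhs t) FF u _ (@uc t).
have h3 := @cvg_enorm R m _ (nbhs t) FF v _ (@vc t).
have h4 := cvgV n0 (cvgM h2 h3); exact: (cvgM h1 (h4 FF FF)).
Qed.

(** Gronwall along one pair of trajectories. The source grows like [expR ((3 * C + lam) * s)]; once
    the factor [expR (3 * C * s)] is removed, [expR (lam * s)] is left to integrate, whence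
    [M / lam]. *)
Lemma trajectory_comparison t : 0 <= t <= T ->
  e t <= expR (3 * C * t) * (e 0 + M / lam * (expR (lam * t) - 1)).
Proof.
move=> /andP[t0 tT].
have C0 : 0 <= C by exact: le_trans (opnorm_ge0 _) (BC 0).
have E0 : 0 < expR (3 * C * t) by exact: expR_gt0.
suff : e t * expR (- (3 * C * t)) <= e 0 + M / lam * (expR (lam * t) - 1).
  by rewrite expRN ler_pdivrMr// mulrC.
(* The slack [d] pays for replacing the distance [e] by the differentiable [sqrt (e ^ 2 + d ^ 2)],
   which dominates [e] and exceeds it by at most [d] at time 0. *)
apply/ler_addgt0Pr => d d0.
pose p s := 2 - 2 * c s + d ^+ 2.
have p0 s : 0 < p s by rewrite /p -e2 ltr_wpDl ?sqr_ge0// exprn_gt0.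
pose f s := Num.sqrt (p s).
have f0 s : 0 < f s by rewrite sqrtr_gt0.
have ef s : e s <= f s.
  have es : 0 <= e s by exact: enorm_ge0.
  by rewrite -(ger0_norm es) -sqrtr_sqr ler_sqrt ?(ltW (p0 s))// e2 lerDl sqr_ge0.
have f2 s : f s ^+ 2 = e s ^+ 2 + d ^+ 2 by rewrite sqr_sqrtr ?(ltW (p0 s))// e2.
have fe0 : f 0 <= e 0 + d.
  rewrite -ler_sqr ?nnegrE ?addr_ge0 ?enorm_ge0 ?(ltW (f0 0)) ?(ltW d0)// f2 sqrrD.
  have : 0 <= e 0 * d by rewrite mulr_ge0 ?enorm_ge0// ltW.
  lra.
pose dcv s := dotv (A s *m x s) (y s) + dotv (x s) (B s *m y s)
     - dotv (x s) (y s) * (dotv (x s) (A s *m x s) + dotv (y s) (B s *m y s)).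
have df (s : R) : 0 < s -> is_derive s 1 f (- dcv s / f s).
  move=> s0.
  have h1 := is_derive_add (is_derive_sub (is_derive_cst (2 : R) s (1 : R))
    (is_derive_scale 2 (dc s0))) (is_derive_cst (d ^+ 2) s (1 : R)).
  apply: is_derive_eq (is_derive_chain (is_derive1_sqrt (p0 s)) h1) _.
  rewrite -/(f s) -/(dcv s); have := f0 s; rewrite lt0r => /andP[fn _].
  by field.
have fb (s : R) : 0 < s <= t -> - dcv s / f s <= 2 * C * f s + M * expR ((3 * C + lam) * s).
  move=> /andP[s0 st].
  have h1 := @angle_derivative_bound (A s) (B s) (x s) (y s) C (nx s) (ny s) (BC s).
  rewrite -/(e s) -/(dcv s) in h1.
  have h2 : opnorm (A s - B s) <= M * expR ((3 * C + lam) * s).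
    by apply: AB; rewrite s0 (le_trans st).
  rewrite ler_pdivrMr//; apply: le_trans h1 _.
  have h3 : e s * opnorm (A s - B s) <= M * expR ((3 * C + lam) * s) * f s.
    by rewrite mulrC ler_pM ?opnorm_ge0 ?enorm_ge0.
  have h4 : 2 * C * e s ^+ 2 <= 2 * C * f s * f s.
    rewrite (_ : 2 * C * f s * f s = 2 * C * f s ^+ 2); last by ring.
    by rewrite f2 ler_wpM2l ?mulr_ge0// lerDl sqr_ge0.
  by rewrite mulrDl; lra.
pose w s := f s * expR (- (3 * C) * s).
have fc : continuous f.
  move=> s; apply: (cvg_comp p Num.sqrt _ (@sqrt_continuous R _)).
  apply: cvgD; last exact: cvg_cst.
  by apply: cvgB; [exact: cvg_cst|apply: cvgM; [exact: cvg_cst|exact: ccont]].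
have ec (a : R) : continuous (fun s => 1 * expR (a * s)).
  by move=> s; exact: is_derive_continuous (is_derive_expRM 1 a s).
have wc : continuous w.
  move=> s; apply: cvgM; first exact: fc.
  by have := ec (- (3 * C)) s; under eq_fun do rewrite mul1r.
have hw : w t - w 0 <= M / lam * expR (lam * t) - M / lam * expR (lam * 0).
  apply: (@le_increment R w (fun s => - dcv s / f s * expR (- (3 * C) * s) +
      f s * (1 * (- (3 * C)) * expR (- (3 * C) * s)))
    (fun s => M / lam * expR (lam * s)) (fun s => M / lam * lam * expR (lam * s)) 0 t t0).
  - move=> s /andP[s0 _]; apply: is_derive_mul; first exact: df.
    have := is_derive_expRM 1 (- (3 * C)) s.
    by have -> : (fun s => 1 * expR (- (3 * C) * s)) = (fun s => expR (- (3 * C) * s))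
      by apply/funext => r; rewrite mul1r.
  - by move=> s _; exact: is_derive_expRM.
  - move=> s /andP[s0 st]; have h := fb s; rewrite s0 (ltW st) in h.
    have {}h := h isT.
    rewrite divfK ?gt_eqF// mul1r.
    have -> : expR (lam * s) = expR ((3 * C + lam) * s) * expR (- (3 * C) * s).
      by rewrite -expRD; congr expR; ring.
    rewrite mulrA mulrA -mulrDl ler_wpM2r ?expR_ge0//.
    (* The drift is at most [2 * C * f] while the weight removes [3 * C * f]; the difference has the
       right sign. *)
    have : 0 <= C * f s by rewrite mulr_ge0// ltW.
    by move: h; lra.
  - exact: continuous_subspaceT.
  - apply: continuous_subspaceT => s; exact: is_derive_continuous (is_derive_expRM _ _ s).
have wt : e t * expR (- (3 * C * t)) <= w t.
  by rewrite /w mulNr ler_wpM2r ?expR_ge0.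
have w0 : w 0 <= e 0 + d by rewrite /w mulr0 expR0 mulr1.
by move: hw wt w0; rewrite mulr0 expR0; lra.
Qed.

End trajectory_comparison.

Lemma dist_lt_gap (R : realDomainType) (a b c : R) : `|b - c| < a - b -> ~ a <= c.
Proof. by rewrite ltr_norml => h1 h2; lra. Qed.

(** * Growth of the cost of a transported coupling *)

Section flow_stability.
Context (R : realType) (d : nat).
Notation V := 'cV[R]_d.+1.
Notation S := (sphere R d).

Definition is_flow (A G : R -> 'M[R]_d.+1) :=
  [/\ forall i j, continuous (fun t => G t i j),
      G 0 = 1%:M,
      forall t : R, 0 < t -> forall i j,
        is_derive t 1 (fun s => G s i j) ((A t *m G t) i j) &
      forall t, G t \in unitmx].

Definition flow (G : R -> 'M[R]_d.+1) (t : R) (x : S) : S :=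
  normalize (G t *m spval x).

Lemma spval_flow G t x : G t \in unitmx ->
  spval (flow G t x) = (enorm (G t *m spval x))^-1 *: (G t *m spval x).
Proof.
by move=> uG; rewrite normalizeE// unitmx_mul_neq0// spval_neq0.
Qed.

Lemma sphere_map_measurable (f : S -> S) : continuous (fun x => spval (f x)) ->
  measurable_fun setT f.
Proof.
move=> cf; apply: (measurability (@open S)) => //.
move=> _ [U oU <-]; rewrite setTI; apply: open_sphere_measurable.
have [W oW ->] := sphere_openP oU.
by move/continuousP: cf => /(_ W oW).
Qed.

Lemma flow_measurable G t : G t \in unitmx -> measurable_fun setT (flow G t).
Proof.
move=> uG; apply: sphere_map_measurable.
rewrite (_ : (fun x => _) = fun x => (enorm (G t *m spval x))^-1 *: (G t *m spval x)).
  move=> x; have FF : Filter (nbhs x) by exact: nbhs_filter.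
  have h1 : (fun y : S => G t *m spval y) @ x --> G t *m spval x.
    exact: (cvg_mulmx (cvg_cst (G t)) (@spval_continuous R d x)).
  have n0 : enorm (G t *m spval x) != 0.
    by rewrite enorm_eq0 unitmx_mul_neq0// spval_neq0.
  exact: (cvgZ (cvgV n0 (cvg_enorm h1)) h1).
by apply/funext => x; exact: spval_flow.
Qed.

Variables (A B G K : R -> 'M[R]_d.+1).
Hypothesis AG : is_flow A G.
Hypothesis BK : is_flow B K.

Let uG t : G t \in unitmx. Proof. by case: AG. Qed.
Let uK t : K t \in unitmx. Proof. by case: BK. Qed.

Lemma flow_pair_measurable t :
  measurable_fun setT (fun z : S * S => (flow G t z.1, flow K t z.2)).
Proof.
apply: measurable_fun_pair.
- exact: measurableT_comp (flow_measurable (uG t)) measurable_fst.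
- exact: measurableT_comp (flow_measurable (uK t)) measurable_snd.
Qed.

Definition flow_coupling (pi : probability (S * S)%type R) t :
  probability (S * S)%type R := pushprob pi (flow_pair_measurable t).

Lemma flow_coupling_cost pi t : cost (flow_coupling pi t) =
  \int[pi]_z enorm (spval (flow G t z.1) - spval (flow K t z.2)).
Proof.
rewrite /cost (@Rintegral_pushprob _ _ _ _ R pi _ (flow_pair_measurable t)
  (fun z => enorm (spval z.1 - spval z.2)) 2)//; first exact: measurable_dist_sphere.
by move=> z; rewrite ger0_norm ?enorm_ge0// dist_sphere_le2.
Qed.

Lemma flow_coupling_dist_measurable t : measurable_fun setT
  (fun z : S * S => enorm (spval (flow G t z.1) - spval (flow K t z.2))).
Proof.
exact: (measurableT_comp (@measurable_dist_sphere R d) (flow_pair_measurable t)).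
Qed.

Lemma flow_coupling_cost0 pi : cost (flow_coupling pi 0) = cost pi.
Proof.
rewrite flow_coupling_cost; apply: eq_Rintegral => z _.
rewrite /flow; case: AG => _ -> _ _; case: BK => _ -> _ _.
by rewrite !mul1mx !normalize_spval.
Qed.

Variables (C L : R).
Hypothesis L0 : 0 <= L.
Hypothesis BC : forall t, opnorm (B t) <= C.
Variable pi : probability (S * S)%type R.
Hypothesis AB : forall t, 0 <= t -> opnorm (A t - B t) <= L * cost (flow_coupling pi t).

Let D t := cost (flow_coupling pi t).

Let trajectory z (lam T t M : R) : 0 < lam ->
  (forall s, 0 < s <= T -> opnorm (A s - B s) <= M * expR ((3 * C + lam) * s)) ->
  0 <= t <= T ->
  enorm (spval (flow G t z.1) - spval (flow K t z.2)) <=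
  expR (3 * C * t) * (enorm (spval z.1 - spval z.2) + M / lam * (expR (lam * t) - 1)).
Proof.
move=> lam0 hM ht; case: AG => Gc G0 dG _; case: BK => Kc K0 dK _.
have curve (H Q : R -> 'M[R]_d.+1) (x : S) :
    (forall i j, continuous (fun t => H t i j)) ->
    (forall t : R, 0 < t -> forall i j,
      is_derive t 1 (fun s => H s i j) ((Q t *m H t) i j)) ->
    continuous (fun t => H t *m spval x) /\ (forall t : R, 0 < t -> forall i,
      is_derive t 1 (fun s => (H s *m spval x) i 0) ((Q t *m (H t *m spval x)) i 0)).
  move=> Hc dH; split.
    move=> s; have FF : Filter (nbhs s) by exact: nbhs_filter.
    have h1 : H @ s --> H s by apply: cvg_mx_entries => i j; exact: Hc.
    exact: (cvg_mulmx h1 (cvg_cst (spval x))).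
  move=> s s0 i.
  have -> : (fun s => (H s *m spval x) i 0) = (fun s => \sum_k spval x k 0 * H s i k).
    by apply/funext => u; rewrite mxE; apply: eq_bigr => k _; rewrite mulrC.
  rewrite mulmxA mxE.
  rewrite (eq_bigr (fun k => spval x k 0 * (Q s *m H s) i k)); last by move=> k _; rewrite mulrC.
  by apply: is_derive_bigsum => k; apply: is_derive_scale; exact: dH.
have [c1 d1] := curve G A z.1 Gc dG.
have [c2 d2] := curve K B z.2 Kc dK.
have := @trajectory_comparison R d.+1 A B (fun t => G t *m spval z.1)
  (fun t => K t *m spval z.2) C M lam T c1 c2 d1 d2
  (fun s => unitmx_mul_neq0 (uG s) (spval_neq0 z.1))
  (fun s => unitmx_mul_neq0 (uK s) (spval_neq0 z.2)) lam0 BC hM t ht.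
rewrite -!spval_flow// /flow G0 K0 !mul1mx !normalize_spval.
by [].
Qed.

Lemma flow_stability t : 0 <= t -> cost (flow_coupling pi t) <=
  expR ((3 * C + L) * t) * cost pi.
Proof.
move=> t0; rewrite -(flow_coupling_cost0 pi) -/(D t) -/(D 0).
have C0 : 0 <= C by exact: le_trans (opnorm_ge0 _) (BC 0).
have D0 s : 0 <= D s by exact: cost_ge0.
have D2 s : D s <= 2 by exact: cost_le2.
(* With [lam = L + eps] the ratio [L / lam] is strictly below 1, which the supremum argument
   requires; [lam] is positive even if [L = 0]. *)
suff key (eps : R) : 0 < eps -> D t <= expR ((3 * C + L + eps) * t) * D 0.
  rewrite leNgt; apply/negP => hlt.
  have cv : (fun eps => expR ((3 * C + L + eps) * t) * D 0) @ 0^'+ -->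
      expR ((3 * C + L) * t) * D 0.
    apply: cvg_at_right_filter; apply: cvgM; last exact: cvg_cst.
    rewrite -[X in _ --> expR (X * t)]addr0.
    apply: (cvg_comp _ expR _ (@continuous_expR R _)).
    by apply: cvgM; [apply: cvgD; [exact: cvg_cst|exact: cvg_id]|exact: cvg_cst].
  have gap : 0 < D t - expR ((3 * C + L) * t) * D 0 by rewrite subr_gt0.
  have near_gap : \forall eps \near 0^'+, `|expR ((3 * C + L) * t) * D 0 -
      expR ((3 * C + L + eps) * t) * D 0| < D t - expR ((3 * C + L) * t) * D 0.
    by move/cvgrPdist_lt: cv => /(_ _ gap).
  have [eps [e0 he]] := filter_ex (filterI (nbhs_right_gt 0) near_gap).
  exact: dist_lt_gap he (key eps e0).
move=> eps0; set lam := L + eps; have lam0 : 0 < lam by rewrite ltr_wpDl.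
pose E s := D s * expR (- ((3 * C + lam) * s)).
have E0 : E 0 = D 0 by rewrite /E mulr0 oppr0 expR0 mulr1.
(* The supremum is finite because the diameter of the sphere bounds every cost by 2 and the weight
   is at most 1. *)
have hs : has_sup [set E s | s in [set s | 0 <= s <= t]].
  split; first by exists (E 0), 0 => //=; rewrite lexx.
  exists 2 => _ [s /= /andP[s0 _] <-]; rewrite /E -[leRHS]mulr1 ler_pM ?expR_ge0//.
  by rewrite -[leRHS]expR0 ler_expR oppr_le0 mulr_ge0// addr_ge0 ?mulr_ge0// ltW.
(* [Sup] is the least constant with [D s <= Sup * expR ((3 * C + lam) * s)] on
   [0, t]. The comparison of trajectories bounds [E s] by a convex combination of
   [D 0] and [L / lam * Sup], and [L < lam], so [Sup > D 0] is impossible. *)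
set Sup := sup [set E s | s in [set s | 0 <= s <= t]].
have leS s : 0 <= s <= t -> E s <= Sup by move=> h; apply: ub_le_sup; [exact: hs.2|exists s].
have S0 : 0 <= Sup.
  by apply: le_trans (leS 0 _); [rewrite E0|rewrite lexx].
have hM s : 0 < s <= t -> opnorm (A s - B s) <= L * Sup * expR ((3 * C + lam) * s).
  move=> /andP[s0 st]; apply: le_trans (AB (ltW s0)) _; rewrite -mulrA ler_wpM2l//.
  by rewrite -ler_pdivrMr ?expR_gt0// -expRN; apply: leS; rewrite ltW.
have step s : 0 <= s <= t ->
    D s <= expR (3 * C * s) * (D 0 + L * Sup / lam * (expR (lam * s) - 1)).
  move=> hst.
  rewrite {1}/D flow_coupling_cost /D flow_coupling_cost0.
  have md := @measurable_dist_sphere R d.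
  have bd (z : S * S) : `|enorm (spval z.1 - spval z.2)| <= 2.
    by rewrite ger0_norm ?enorm_ge0// dist_sphere_le2.
  set k := L * Sup / lam * (expR (lam * s) - 1).
  have id := bounded_integrable pi md bd.
  have ik := @bounded_integrable _ _ _ pi (fun=> k) `|k| (measurable_cst _) (fun=> lexx _).
  have mk : measurable_fun setT (fun z : S * S => enorm (spval z.1 - spval z.2) + k).
    exact: measurable_funD.
  have bk (z : S * S) : `|enorm (spval z.1 - spval z.2) + k| <= 2 + `|k|.
    by apply: le_trans (ler_normD _ _) _; rewrite lerD2r.
  have ek : cost pi + k = \int[pi]_z (enorm (spval z.1 - spval z.2) + k).
    by rewrite RintegralD// Rintegral_prob_cst.
  have idk := bounded_integrable pi mk bk.
  rewrite ek -RintegralZl//.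
  apply: (@le_Rintegral_prob _ _ _ pi _ _ 2 (expR (3 * C * s) * (2 + `|k|))).
  - exact: flow_coupling_dist_measurable.
  - by move=> z; rewrite ger0_norm ?enorm_ge0// dist_sphere_le2.
  - exact: measurable_funM.
  - by move=> z; rewrite normrM (ger0_norm (expR_ge0 _)) ler_wpM2l// expR_ge0.
  - by move=> z; exact: (trajectory z lam0 hM hst).
have r1 s : 0 <= s <= t -> E s <= Num.max (D 0) (L / lam * Sup).
  move=> hst; have := step s hst.
  rewrite -(ler_pM2r (expR_gt0 (- ((3 * C + lam) * s)))) -/(E s) => /le_trans; apply.
  set th := expR (- (lam * s)).
  have th1 : th <= 1.
    by move: hst => /andP[s0 _]; rewrite /th -[leRHS]expR0 ler_expR oppr_le0 mulr_ge0// ltW.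
  have th0 : 0 <= th by exact: expR_ge0.
  have e1 : expR (3 * C * s) * expR (- ((3 * C + lam) * s)) = th.
    by rewrite -expRD; congr expR; ring.
  have e2 : expR (lam * s) * th = 1 by rewrite /th -expRD subrr expR0.
  have -> : expR (3 * C * s) * (D 0 + L * Sup / lam * (expR (lam * s) - 1)) *
      expR (- ((3 * C + lam) * s)) = th * D 0 + (1 - th) * (L / lam * Sup).
    rewrite mulrAC e1; transitivity (th * D 0 + L * Sup / lam * (expR (lam * s) * th - th)).
      by ring.
    by rewrite e2; ring.
  set mx := Num.max _ _.
  have h1 : D 0 <= mx by rewrite /mx le_max lexx.
  have h2 : L / lam * Sup <= mx by rewrite /mx le_max lexx orbT.
  have -> : mx = th * mx + (1 - th) * mx by ring.
  by rewrite lerD// ler_wpM2l// subr_ge0.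
have SD : Sup <= D 0.
  rewrite leNgt; apply/negP => hlt.
  have Sp : 0 < Sup by exact: le_lt_trans (D0 0) hlt.
  have : Sup <= Num.max (D 0) (L / lam * Sup).
    by apply: ge_sup; [exact: hs.1|move=> _ [s hst <-]; exact: r1].
  rewrite leNgt gt_max hlt /= -[X in _ < X]mul1r ltr_pM2r// ltr_pdivrMr// mul1r.
  by rewrite /lam ltrDl eps0.
have := leS t; rewrite t0 lexx => /(_ isT) /le_trans /(_ SD).
rewrite /E expRN ler_pdivrMr ?expR_gt0// mulrC.
by rewrite /lam addrA.
Qed.

End flow_stability.

(** * Curves of measures driven by a Lipschitz field *)

Section coordinate_continuity.
Context (R : realType) (d : nat).

Lemma spval_coord_continuous j : continuous (fun x : sphere R d => spval x j 0).
Proof.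
move=> x; have FF : Filter (nbhs x) by exact: nbhs_filter.
exact: (cvg_coord (@spval_continuous R d x)).
Qed.

Lemma sgradient_coord_continuous (psi : sphere R d -> R) i : C1_sphere psi ->
  continuous (fun x => sgradient psi x i 0).
Proof.
move=> h x; have FF : Filter (nbhs x) by exact: nbhs_filter.
exact: (cvg_coord (@C1_sphere_gradient_continuous R d psi h x)).
Qed.

Lemma sgradient_spval_continuous (psi : sphere R d -> R) i j : C1_sphere psi ->
  continuous (fun x => sgradient psi x i 0 * spval x j 0).
Proof.
move=> h x; have FF : Filter (nbhs x) by exact: nbhs_filter.
exact: (cvgM (@sgradient_coord_continuous psi i h x) (@spval_coord_continuous j x)).
Qed.

End coordinate_continuity.

Section lipschitz_field.
Context (R : realType) (d : nat).
Notation V := 'cV[R]_d.+1.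
Notation S := (sphere R d).
Variables (F : probability S R -> 'M[R]_d.+1) (L : R).
Hypothesis hL : 0 <= L.
Hypothesis hF : forall mu nu : probability S R,
  ((opnorm (F mu - F nu))%:E <= L%:E * W1 mu nu)%E.

(** Every measure is within [W1]-distance 2 of one fixed Dirac mass, so the Lipschitz bound keeps
    [F] bounded. *)
Lemma CF_fin : exists2 C : R, 0 <= C & CF F = C%:E.
Proof.
pose delta : probability S R := [the probability S R of \d_(point : S)].
have bd mu : opnorm (F mu) <= L * 2 + opnorm (F delta).
  rewrite -{1}(subrK (F delta) (F mu)); apply: le_trans (opnormD _ _) _.
  rewrite lerD2r -lee_fin EFinM; apply: le_trans (hF _ _) _.
  by apply: lee_pmul => //; [exact: W1_ge0|exact: W1_dirac_le2].
have h1 : (CF F <= (L * 2 + opnorm (F delta))%:E)%E.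
  by apply: ge_ereal_sup => _ [mu _ <-]; rewrite lee_fin.
have h2 : (0 <= CF F)%E.
  apply: (@le_trans _ _ (opnorm (F delta))%:E); first by rewrite lee_fin opnorm_ge0.
  by apply: ereal_sup_ubound; exists delta.
have fin : CF F \is a fin_num by rewrite ge0_fin_numE// (le_lt_trans h1)// ltry.
by exists (fine (CF F)); [exact: fine_ge0|rewrite fineK].
Qed.

Lemma opnorm_le_CF mu : opnorm (F mu) <= fine (CF F).
Proof.
have [C _ e] := CF_fin; rewrite e /= -lee_fin -e.
by apply: ereal_sup_ubound; exists mu.
Qed.

Section curve.
Variable mu : R -> probability S R.
Hypothesis Wc : forall (s e : R), 0 < e -> \forall r \near s, (W1 (mu r) (mu s) < e%:E)%E.

Lemma curve_Rintegral_continuous (f : S -> R) : continuous f ->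
  continuous (fun s => \int[mu s]_x f x).
Proof.
move=> cf s; apply/cvgrPdist_le => e e0.
have e2 : 0 < e / 2 by rewrite divr_gt0.
have [K K0 fK] := continuous_sphere_modulus cf e2.
have eK : 0 < e / 2 / K by rewrite divr_gt0.
near=> r.
have hr : (W1 (mu r) (mu s) < (e / 2 / K)%:E)%E by near: r; exact: Wc.
rewrite distrC; apply: le_trans (Rintegral_W1 (ltW K0) _ _ fK hr) _.
- exact: continuous_sphere_measurable.
- exact: continuous_sphere_bounded.
- by rewrite [K * _]mulrC divfK ?gt_eqF//; lra.
Unshelve. all: by end_near. Qed.

Lemma curve_F_continuous i j : continuous (fun s => F (mu s) i j).
Proof.
move=> s; apply/cvgrPdist_le => e e0.
have eL : 0 < e / (L + 1) by rewrite divr_gt0// ltr_wpDl.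
near=> r.
have hr : (W1 (mu r) (mu s) < (e / (L + 1))%:E)%E by near: r; exact: Wc.
have := coord_opnorm (F (mu r) - F (mu s)) i j.
rewrite !mxE distrC => /le_trans; apply.
rewrite -lee_fin; apply: le_trans (hF _ _) _.
apply: le_trans (lee_wpmul2l _ (ltW hr)) _; first by rewrite lee_fin.
rewrite -EFinM lee_fin mulrA ler_pdivrMr ?ltr_wpDl// mulrC ler_wpM2l ?(ltW e0)//.
by rewrite lerDl.
Unshelve. all: by end_near. Qed.

(** Separates the time-dependent matrix from integrals of fixed continuous functions, so that
    continuity in time can be checked factor by factor. *)
Lemma bfield_Rintegral psi (nu : probability S R) (s : R) : C1_sphere psi ->
  \int[nu]_x dotv (sgradient psi x) (bfield F x (mu s)) =
  \sum_i \sum_j F (mu s) i j * \int[nu]_x (sgradient psi x i 0 * spval x j 0).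
Proof.
move=> hpsi.
have cm i j := @sgradient_spval_continuous R d psi i j hpsi.
have im i j := continuous_sphere_integrable nu (cm i j).
have cF i j : continuous (fun x : S => F (mu s) i j * (sgradient psi x i 0 * spval x j 0)).
  by move=> x; exact: (cvgM (cvg_cst (F (mu s) i j)) (cm i j x)).
have iF i j : nu.-integrable setT
    (EFin \o (fun x : S => F (mu s) i j * (sgradient psi x i 0 * spval x j 0))).
  exact: continuous_sphere_integrable.
transitivity (\int[nu]_x (\sum_i \sum_j F (mu s) i j * (sgradient psi x i 0 * spval x j 0))).
  apply: eq_Rintegral => x _.
  rewrite dotv_bfield ?dotv_sumE//.
  exact: gradient_hext_radial (spval_neq0 x).
rewrite Rintegral_sum; last first.
  move=> i; apply: continuous_sphere_integrable => x.
  by apply: (@cvg_bigsum _ _ (nbhs x)) => j; exact: cF.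
apply: eq_bigr => i _; rewrite Rintegral_sum//.
by apply: eq_bigr => j _; rewrite RintegralZl.
Qed.

Lemma curve_bfield_continuous psi : C1_sphere psi ->
  continuous (fun s => \int[mu s]_x dotv (sgradient psi x) (bfield F x (mu s))).
Proof.
move=> hpsi; under eq_fun do rewrite (bfield_Rintegral _ _ hpsi).
move=> s; apply: (@cvg_bigsum _ _ (nbhs s)) => i; apply: (@cvg_bigsum _ _ (nbhs s)) => j.
exact: (cvgM (@curve_F_continuous i j s)
  (@curve_Rintegral_continuous _ (@sgradient_spval_continuous R d psi i j hpsi) s)).
Qed.

Hypothesis mu_eq : forall psi, C1_sphere psi -> forall t : R, 0 < t ->
  is_derive t 1 (fun s => \int[mu s]_x psi x)
    (\int[mu t]_x dotv (sgradient psi x) (bfield F x (mu t))).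

(** Along [mu] the matrix [F (mu s)] is a known continuous bounded function, so the linear theory
    applies. The two sides are compared on [C^1] functions, which determine measures. *)
Lemma curve_transport : exists2 G, is_flow (F \o mu) G &
  forall t, 0 <= t -> forall B, measurable B -> mu t B = mu 0 (flow G t @^-1` B).
Proof.
have AK t i j : `|F (mu t) i j| <= fine (CF F).
  exact: le_trans (coord_opnorm _ _ _) (opnorm_le_CF _).
have [G [H [GHc GH0 dG dH HG]]] := linear_flow_exists curve_F_continuous AK.
have uG t : G t \in unitmx := (mulmx1_unit (HG t)).2.
exists G; first by split => //; [move=> i j; exact: (GHc i j).1|exact: (GH0 0 (lexx 0)).1].
move=> t t0 B mB.
have -> : mu 0 (flow G t @^-1` B) = pushprob (mu 0) (flow_measurable (uG t)) B by [].
apply: C1_sphere_determines => // psi hpsi.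
have cpsi := C1_sphere_continuous hpsi.
have [M psiM] := continuous_sphere_bounded cpsi.
rewrite (Rintegral_pushprob _ _ (continuous_sphere_measurable cpsi) psiM).
apply: (transport_integral curve_F_continuous curve_Rintegral_continuous _ GHc GH0 dH HG hpsi t0).
move=> phi hphi s s0; apply: is_derive_eq (mu_eq hphi s0) _.
apply: eq_Rintegral => x _; rewrite dotv_bfield//.
exact: gradient_hext_radial (spval_neq0 x).
Qed.

End curve.

Lemma curves_W1_stability (mu nu : R -> probability S R) :
  (forall (s e : R), 0 < e -> \forall r \near s, (W1 (mu r) (mu s) < e%:E)%E) ->
  (forall psi, C1_sphere psi -> forall t : R, 0 < t ->
    is_derive t 1 (fun s => \int[mu s]_x psi x)
      (\int[mu t]_x dotv (sgradient psi x) (bfield F x (mu t)))) ->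
  (forall (s e : R), 0 < e -> \forall r \near s, (W1 (nu r) (nu s) < e%:E)%E) ->
  (forall psi, C1_sphere psi -> forall t : R, 0 < t ->
    is_derive t 1 (fun s => \int[nu s]_x psi x)
      (\int[nu t]_x dotv (sgradient psi x) (bfield F x (nu t)))) ->
  forall t, 0 <= t -> (W1 (mu t) (nu t) <=
    (expR ((3 * fine (CF F) + L) * t))%:E * W1 (mu 0%R) (nu 0%R))%E.
Proof.
move=> Wmu emu Wnu enu t t0.
have [G fG muG] := curve_transport Wmu emu.
have [K fK nuK] := curve_transport Wnu enu.
have uG s : G s \in unitmx by case: fG.
have uK s : K s \in unitmx by case: fK.
set E := expR _; have E0 : 0 < E by exact: expR_gt0.
(* The positive factor passes inside the infimum, so each coupling of the initial values can be
   treated separately, without an optimal one. *)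
rewrite -ereal_inf_pZl//; apply: le_ereal_inf_tmp => _ [_ [pi hpi <-] <-].
rewrite costE -EFinM.
have hc s : 0 <= s -> coupling (mu s) (nu s) (flow_coupling fG fK pi s).
  move=> s0 B mB; rewrite muG// nuK//.
  have mG : measurable (flow G s @^-1` B).
    by rewrite -[X in measurable X]setTI; exact: flow_measurable.
  have mK : measurable (flow K s @^-1` B).
    by rewrite -[X in measurable X]setTI; exact: flow_measurable.
  by split; [exact: (hpi _ mG).1|exact: (hpi _ mK).2].
apply: le_trans (W1_le_cost (hc t t0)) _; rewrite lee_fin.
apply: flow_stability => //.
- by move=> s; exact: opnorm_le_CF.
- move=> s s0; rewrite -lee_fin EFinM; apply: le_trans (hF _ _) _.
  by apply: lee_wpmul2l; [rewrite lee_fin|exact: W1_le_cost (hc s s0)].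
Qed.

End lipschitz_field.

(** * Empirical measures *)

(* The coupling of two empirical measures lives on the product of two spheres,
   where [empirical] is not available. *)
Section discrete_uniform.
Context (disp : measure_display) (T : measurableType disp) (R : realType) (n : nat)
  (z : 'I_n.+1 -> T).

Definition discrete_uniform (A : set T) : \bar R :=
  ((n.+1%:R^-1 : R)%:E * \sum_(k < n.+1) \d_(z k) A)%E.

Let invn_ge0 : 0 <= n.+1%:R^-1 :> R. Proof. by []. Qed.

Lemma discrete_uniformE : discrete_uniform =
  mscale (NngNum invn_ge0)
    (msum (fun k => [the {measure set T -> \bar R} of \d_(z (inord k))]) n.+1).
Proof.
apply/funext => A; rewrite /discrete_uniform /mscale /msum /=; congr (_ * _)%E.
by apply: eq_bigr => k _; rewrite inord_val.
Qed.

Let discrete_uniform0 : discrete_uniform set0 = 0%E.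
Proof. by rewrite discrete_uniformE measure0. Qed.

Let discrete_uniform_ge0 A : (0 <= discrete_uniform A)%E.
Proof. by rewrite discrete_uniformE. Qed.

Let discrete_uniform_sigma_additive : semi_sigma_additive discrete_uniform.
Proof. by rewrite discrete_uniformE; exact: measure_semi_sigma_additive. Qed.

HB.instance Definition _ := isMeasure.Build _ _ _ discrete_uniform
  discrete_uniform0 discrete_uniform_ge0 discrete_uniform_sigma_additive.

Let discrete_uniform_setT : discrete_uniform setT = 1%E.
Proof.
rewrite /discrete_uniform (eq_bigr (fun=> 1%:E)); last by move=> k _; rewrite diracT.
by rewrite sumEFin -EFinM sumr_const card_ord mulVf// pnatr_eq0.
Qed.

HB.instance Definition _ := Measure_isProbability.Build _ _ _ discrete_uniform
  discrete_uniform_setT.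

Lemma Rintegral_discrete_uniform (f : T -> R) (M : R) : measurable_fun setT f ->
  (forall x, `|f x| <= M) ->
  Rintegral discrete_uniform setT f = n.+1%:R^-1 * \sum_(k < n.+1) f (z k).
Proof.
move=> mf fM.
(* Nonnegative functions come first, since integrals against sums of measures are additive for them;
   a bounded [f] is then shifted by [M]. *)
have pos (g : T -> R) : measurable_fun setT g -> (forall x, 0 <= g x) ->
    Rintegral discrete_uniform setT g = n.+1%:R^-1 * \sum_(k < n.+1) g (z k).
  move=> mg g0; rewrite /Rintegral.
  have mE : measurable_fun setT (EFin \o g) by exact/measurable_EFinP.
  rewrite (@eq_measure_integral _ _ _ _ (mscale (NngNum invn_ge0)
    (msum (fun k => [the {measure set T -> \bar R} of \d_(z (inord k))]) n.+1))); last first.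
    by move=> A mA _; rewrite /= -/discrete_uniform discrete_uniformE.
  rewrite ge0_integral_mscale//; last by move=> x _; rewrite lee_fin.
  rewrite ge0_integral_measure_sum//; last by move=> x _; rewrite lee_fin.
  rewrite (eq_bigr (fun k : 'I_n.+1 => (g (z k))%:E)).
    by rewrite sumEFin -EFinM.
  move=> k _; rewrite integral_dirac// ?diracT ?mul1e//= inord_val.
  by [].
have mfM : measurable_fun setT (fun x => f x + M) by exact: measurable_funD.
have := pos _ mfM (fun x => ltac:(by have := fM x; rewrite ler_norml; lra)).
rewrite RintegralD//; last 2 first.
- exact: bounded_integrable mf fM.
- exact: (@bounded_integrable _ _ _ discrete_uniform (fun=> M) `|M|).
rewrite Rintegral_prob_cst big_split /= sumr_const card_ord mulrDr -[M *+ _]mulr_natl mulrA.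
by rewrite mulVf ?pnatr_eq0// mul1r => /addIr.
Qed.

End discrete_uniform.

Section empirical_facts.
Context (R : realType) (d n : nat).
Notation S := (sphere R d).

Lemma Rintegral_empirical (z : 'I_n.+1 -> S) (f : S -> R) : continuous f ->
  Rintegral (empirical z) setT f = n.+1%:R^-1 * \sum_(k < n.+1) f (z k).
Proof.
move=> cf; have [M fM] := continuous_sphere_bounded cf.
rewrite -(Rintegral_discrete_uniform z (continuous_sphere_measurable cf) fM).
by congr fine; apply: eq_measure_integral.
Qed.

(** Matching points of equal index is an admissible coupling. It turns continuity of the particles
    into [W1]-continuity of their empirical measure. *)
Lemma W1_empirical (z w : 'I_n.+1 -> S) : (W1 (empirical z) (empirical w) <=
  (n.+1%:R^-1 * \sum_(k < n.+1) enorm (spval (z k) - spval (w k)))%:E)%E.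
Proof.
pose pi : probability (S * S)%type R := discrete_uniform R (fun k => (z k, w k)).
have hpi : coupling (empirical z) (empirical w) pi.
  move=> A mA; split; rewrite /pi /= /discrete_uniform /empirical; congr (_ * _)%E;
    apply: eq_bigr => k _; rewrite !diracE; congr ((nat_of_bool _)%:R)%:E.
  - by apply/idP/idP; rewrite !inE => //= -[].
  - by apply/idP/idP; rewrite !inE => //= -[].
apply: le_trans (W1_le_cost hpi) _; rewrite lee_fin /cost.
rewrite (@Rintegral_discrete_uniform _ _ _ _ _ _ 2)//; first exact: measurable_dist_sphere.
by move=> x; rewrite ger0_norm ?enorm_ge0// dist_sphere_le2.
Qed.

End empirical_facts.

(** * Weak solutions and particle systems *)

Section clamp.
Context (R : realType).

(* Curves on the half-line are extended by their initial value, so that two-sided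
   limits and derivatives are available at all times. *)
Definition clamp (s : R) : R := Num.max 0 s.

Lemma clamp_ge0 s : 0 <= clamp s.
Proof. by rewrite /clamp le_max lexx. Qed.

Lemma clamp_id s : 0 <= s -> clamp s = s.
Proof. by move=> s0; rewrite /clamp max_r. Qed.

Lemma clamp_continuous : continuous clamp.
Proof.
have -> : clamp = (fun s => (s + `|s|) / 2).
  apply/funext => s; have [s0|s0] := leP 0 s; first by rewrite clamp_id// ger0_norm//; lra.
  by rewrite /clamp max_l ?(ltW s0)// ltr0_norm//; lra.
move=> s; apply: (@cvgM _ _ (nbhs s)); last exact: cvg_cst.
apply: (@cvgD _ _ _ (nbhs s)); first exact: cvg_id.
by apply: (@cvg_norm _ _ _ (nbhs s)); exact: cvg_id.
Qed.

(** [clamp] is continuous with values in the half-line, so it pulls one-sided neighbourhoods back to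
    full ones. *)
Lemma near_clamp (s : R) (P : R -> Prop) :
  (\forall r \near within [set r | 0 <= r] (nbhs (clamp s)), P r) ->
  \forall r \near s, P (clamp r).
Proof.
move=> h.
have h' : nbhs s [set r | 0 <= clamp r -> P (clamp r)] := @clamp_continuous s _ h.
by apply: filterS h' => r /=; apply; exact: clamp_ge0.
Qed.

Lemma near_clamp_id (t : R) : 0 < t -> \forall s \near t, s = clamp s.
Proof.
move=> t0; near=> s; rewrite clamp_id//; apply: ltW; near: s; exact: lt_nbhsr.
Unshelve. all: by end_near. Qed.

End clamp.

Section weak_solution_curve.
Context (R : realType) (d : nat).
Notation S := (sphere R d).
Variables (F : probability S R -> 'M[R]_d.+1) (L : R).
Hypothesis hL : 0 <= L.
Hypothesis hF : forall mu nu : probability S R,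
  ((opnorm (F mu - F nu))%:E <= L%:E * W1 mu nu)%E.
Variables (rho0 : probability S R) (rho : R -> probability S R).
Hypothesis hrho : weak_solution F rho0 rho.

Lemma weak_solution_W1_near (s e : R) : 0 < e ->
  \forall r \near s, (W1 (rho (clamp r)) (rho (clamp s)) < e%:E)%E.
Proof.
move=> e0; have [Wc _ _] := hrho.
apply: (@near_clamp R s (fun r => W1 (rho r) (rho (clamp s)) < e%:E)%E).
have h : \forall r \near (0 : R), r < e by exact: lt_nbhsl.
have hn : nbhs (0%E : \bar R) [set y | (y < e%:E)%E] by exact: h.
exact: (@Wc _ (clamp_ge0 s) _ hn).
Qed.

(** [W1]-continuity makes the time integrand continuous, so the integral form of the equation can be
    differentiated by the fundamental theorem of calculus. *)
Lemma weak_solution_derive psi (t : R) : C1_sphere psi -> 0 < t ->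
  is_derive t 1 (fun s => \int[rho (clamp s)]_x psi x)
    (\int[rho (clamp t)]_x dotv (sgradient psi x) (bfield F x (rho (clamp t)))).
Proof.
move=> hpsi t0; have [_ _ weak] := hrho.
pose g s := \int[rho (clamp s)]_x dotv (sgradient psi x) (bfield F x (rho (clamp s))).
have cg : continuous g.
  exact: (curve_bfield_continuous hL hF (mu := rho \o @clamp R) weak_solution_W1_near hpsi).
apply: (@near_eq_is_derive _ _ _ (fun s => \int[rho 0]_x psi x + prim g s)).
  near=> s.
  have s0 : 0 <= s by apply: ltW; near: s; exact: lt_nbhsr.
  rewrite clamp_id//; have := weak psi hpsi s s0 => /eqP; rewrite subr_eq => /eqP ->.
  rewrite addrC; congr (_ + _).
  apply: eq_Rintegral => u; rewrite inE /= in_itv /= => /andP[u0 _].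
  by rewrite /g clamp_id.
rewrite -[X in is_derive _ _ _ X]add0r; apply: is_derive_add.
exact: is_derive_prim.
Unshelve. all: by end_near. Qed.

End weak_solution_curve.

Section particles.
Context (R : realType) (d : nat).
Notation V := 'cV[R]_d.+1.
Notation S := (sphere R d).

(** At a positive time all nearby times are positive, so the restriction to the half-line disappears
    from the limit. *)
Lemma is_derive_nonneg_coord (y : R -> V) (t : R) (v : V) i : 0 < t ->
  is_derive_nonneg y t v -> is_derive t 1 (fun s => y s i 0) (v i 0).
Proof.
move=> t0 hy; apply/is_derive_cvgP/cvgrPdist_lt => e e0.
move/cvgrPdist_lt : hy => /(_ _ e0) h.
have h1 : \forall s \near t, s != t -> 0 <= s -> `|v - (s - t)^-1 *: (y s - y t)| < e.
  exact: h.
have h2 : \forall h \near (0 : R), h + t != t -> 0 <= h + t ->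
    `|v - (h + t - t)^-1 *: (y (h + t) - y t)| < e.
  by move: h1; rewrite (near_shift (0 : R)) subr0.
near=> u.
have u0 : u != 0 by near: u; exact: nbhs_dnbhs_neq.
have ut : `|u| < t by near: u; exact: dnbhs0_lt.
have : `|v - (u + t - t)^-1 *: (y (u + t) - y t)| < e.
  have : u + t != t by rewrite -subr_eq0 addrK.
  have : 0 <= u + t by move: ut; rewrite ltr_norml; lra.
  move=> p1 p2; have := near (cvg_within _ h2) u; apply => //.
rewrite addrK => /(le_lt_trans (coord_normr _ i 0)).
by rewrite !mxE.
Unshelve. all: by end_near. Qed.

Lemma is_derive_nonneg_cvg (y : R -> V) (t : R) (v : V) :
  is_derive_nonneg y t v -> y @ within [set s | 0 <= s] (nbhs t) --> y t.
Proof.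
move=> hy; apply/cvgrPdist_lt => e e0.
move/cvgrPdist_lt : hy => /(_ _ ltr01) h.
have h1 : \forall s \near t, s != t -> 0 <= s -> `|v - (s - t)^-1 *: (y s - y t)| < 1.
  exact: h.
have M0 : 0 < `|v| + 1 by rewrite ltr_wpDl.
have h2 : \forall s \near t, `|t - s| < e / (`|v| + 1).
  have : (fun s : R => s) @ t --> t by exact: cvg_id.
  by move/cvgrPdist_lt => /(_ (e / (`|v| + 1))); apply; rewrite divr_gt0.
have : \forall s \near t, 0 <= s -> `|y t - y s| < e.
  near=> s; move=> s0.
  have [->|st] := eqVneq s t; first by rewrite subrr normr0.
  have st0 : s - t != 0 by rewrite subr_eq0.
  have hq : `|v - (s - t)^-1 *: (y s - y t)| < 1 by move: st s0; near: s; exact: h1.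
  have hd : `|t - s| < e / (`|v| + 1) by near: s; exact: h2.
  (* The difference quotient is within 1 of [v], hence bounded by [|v| + 1]; this explains the
     radius [e / (|v| + 1)]. *)
  have e1 : y t - y s = (t - s) *: ((s - t)^-1 *: (y s - y t)).
    by rewrite scalerA -[t - s]opprB mulNr mulfV// scaleN1r opprB.
  rewrite e1 normrZ.
  have hb : `|(s - t)^-1 *: (y s - y t)| <= `|v| + 1.
    have := ler_normB v (v - (s - t)^-1 *: (y s - y t)).
    by rewrite subKr => /le_trans; apply; rewrite lerD2l ltW.
  apply: le_lt_trans (ler_wpM2l (normr_ge0 _) hb) _.
  by rewrite -ltr_pdivlMr.
by [].
Unshelve. all: by end_near. Qed.

Variables (F : probability S R -> 'M[R]_d.+1) (n : nat) (x0 : 'I_n.+1 -> S)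
  (x : 'I_n.+1 -> R -> S).
Hypothesis hx : particle_solution F x0 x.

Let mu s : probability S R := empirical (fun k => x k (clamp s)).

Lemma particle_continuous k : continuous (fun s => spval (x k (clamp s))).
Proof.
move=> s; have [_ hd] := hx.
have hc := is_derive_nonneg_cvg (hd k (clamp s) (clamp_ge0 s)).
apply/cvgrPdist_lt => e e0.
apply: (@near_clamp R s (fun r => `|spval (x k (clamp s)) - spval (x k r)| < e)).
by move/cvgrPdist_lt : hc => /(_ _ e0).
Qed.

Lemma particle_W1_near (s e : R) : 0 < e -> \forall r \near s, (W1 (mu r) (mu s) < e%:E)%E.
Proof.
move=> e0.
have FF : Filter (nbhs s) by exact: nbhs_filter.
have ck k : (fun r => enorm (spval (x k (clamp r)) - spval (x k (clamp s)))) @ s --> (0 : R).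
  rewrite -(@enorm0 R d.+1) -(subrr (spval (x k (clamp s)))).
  apply: (@cvg_enorm _ _ _ (nbhs s)).
  exact: (cvgB (@particle_continuous k s) (cvg_cst (spval (x k (clamp s))))).
have cs : (fun r => \sum_(k < n.+1) enorm (spval (x k (clamp r)) - spval (x k (clamp s))))
    @ s --> \sum_(k < n.+1) (0 : R) by exact: cvg_bigsum.
rewrite big1// in cs.
have c : (fun r => n.+1%:R^-1 * \sum_(k < n.+1)
     enorm (spval (x k (clamp r)) - spval (x k (clamp s)))) @ s --> n.+1%:R^-1 * (0 : R).
  by have h := cvgM (cvg_cst (n.+1%:R^-1 : R)) cs; exact: h.
rewrite mulr0 in c.
move/cvgrPdist_lt : c => /(_ _ e0); apply: filterS => r.
rewrite sub0r normrN => h; apply: le_lt_trans (W1_empirical _ _) _.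
by rewrite lte_fin; exact: le_lt_trans (ler_norm _) h.
Qed.

(** Integrals against the empirical measure are averages over the particles, and the chain rule
    along each particle gives the weak equation in differentiated form. *)
Lemma particle_derive psi (t : R) : C1_sphere psi -> 0 < t ->
  is_derive t 1 (fun s => \int[mu s]_y psi y)
    (\int[mu t]_y dotv (sgradient psi y) (bfield F y (mu t))).
Proof.
move=> hpsi t0; have [_ hd] := hx.
have cpsi := C1_sphere_continuous hpsi.
have -> : (fun s => \int[mu s]_y psi y) =
    (fun s => n.+1%:R^-1 * \sum_(k < n.+1) psi (x k (clamp s))).
  by apply/funext => s; rewrite Rintegral_empirical.
rewrite Rintegral_empirical; last first.
  have FF (y : S) : Filter (nbhs y) by exact: nbhs_filter.
  have -> : (fun y => dotv (sgradient psi y) (bfield F y (mu t))) =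
     (fun y => \sum_i \sum_j F (mu t) i j * (sgradient psi y i 0 * spval y j 0)).
    apply/funext => y; rewrite dotv_bfield ?dotv_sumE//.
    exact: gradient_hext_radial (spval_neq0 y).
  move=> y; apply: (@cvg_bigsum _ _ (nbhs y)) => i; apply: (@cvg_bigsum _ _ (nbhs y)) => j.
  exact: (cvgM (cvg_cst (F (mu t) i j)) (@sgradient_spval_continuous R d psi i j hpsi y)).
apply: is_derive_scale; apply: is_derive_bigsum => k.
apply: (@near_eq_is_derive _ _ _ (fun s => hext psi (spval (x k s)))).
  apply: filterS (near_clamp_id t0) => s es.
  by rewrite hext_spval -es.
rewrite /mu (clamp_id (ltW t0)).
apply: (@is_derive_curve R d psi (fun s => spval (x k s))) => //; first exact: spval_neq0.
move=> i; have := is_derive_nonneg_coord i t0 (hd k t (ltW t0)).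
by [].
Qed.

End particles.

Theorem corollary2p5 (R : realType) (d : nat)
    (F : probability (sphere R d) R -> 'M[R]_d.+1) (L : R)
    (hL : 0 <= L)
    (hF : forall mu nu : probability (sphere R d) R,
       ((opnorm (F mu - F nu))%:E <= L%:E * W1 mu nu)%E)
    (x0 : forall n : nat, 'I_n.+1 -> sphere R d)
    (x : forall n : nat, 'I_n.+1 -> R -> sphere R d)
    (hx : forall n : nat, particle_solution F (x0 n) (x n))
    (rho0 : probability (sphere R d) R)
    (rho : R -> probability (sphere R d) R)
    (hrho : weak_solution F rho0 rho) :
  [/\ (CF F < +oo)%E,
      forall (n : nat) (t : R), 0 <= t ->
        (W1 (empirical (fun k => x n k t)) (rho t) <=
         (expR ((3 * fine (CF F) + L) * t))%:E
           * W1 (empirical (x0 n)) rho0)%E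
    & (fun n : nat => W1 (empirical (x0 n)) rho0) @ \oo --> 0%E ->
      forall T : R, 0 < T ->
        (fun n : nat =>
           ereal_sup [set W1 (empirical (fun k => x n k t)) (rho t)
                     | t in `[0, T]])
          @ \oo --> 0%E].
Proof.
have [C C0 eC] := CF_fin hL hF.
have main (n : nat) (t : R) : 0 <= t ->
    (W1 (empirical (fun k => x n k t)) (rho t) <=
      (expR ((3 * fine (CF F) + L) * t))%:E * W1 (empirical (x0 n)) rho0)%E.
  move=> t0.
  (* Both curves are extended by [clamp]; at [t] and at 0, which are nonnegative, the extensions
     return the original measures. *)
  have := curves_W1_stability hL hF
    (mu := fun s => [the probability (sphere R d) R of empirical (fun k => x n k (clamp s))])
    (nu := rho \o @clamp R)
    (particle_W1_near (hx n)) (fun psi hpsi s s0 => particle_derive (hx n) hpsi s0)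
    (weak_solution_W1_near hrho)
    (fun psi hpsi s s0 => weak_solution_derive hL hF hrho hpsi s0) t0.
  rewrite /= (clamp_id t0) (clamp_id (lexx 0)).
  have -> : (fun k => x n k 0) = x0 n by apply/funext => k; exact: (hx n).1.
  by have [_ -> _] := hrho.
split => //; first by rewrite eC ltry.
move=> W0 T T0; set E := expR ((3 * fine (CF F) + L) * T).
have K0 : 0 <= 3 * fine (CF F) + L by rewrite eC addr_ge0 ?mulr_ge0.
have up : (fun n => E%:E * W1 (empirical (x0 n)) rho0)%E @ \oo --> 0%E.
  rewrite -(mule0 E%:E); apply: cvgeZl => //.
have bounds : \forall n \near \oo, (cst 0%E n <= ereal_sup
    [set W1 (empirical (fun k => x n k t)) (rho t) | t in `[0%R, T]] <=
    E%:E * W1 (empirical (x0 n)) rho0)%E.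
  exists 0%N => // n _ /=; apply/andP; split.
    (* The supremum is nonnegative because time 0 belongs to the interval. *)
    apply: le_trans (W1_ge0 (empirical (fun k => x n k 0)) (rho 0)) _.
    by apply: ereal_sup_ubound; exists 0 => //=; rewrite in_itv /= lexx ltW.
  apply: ge_ereal_sup => y [t]. rewrite /= in_itv /= => /andP[t0 tT] <-.
  apply: le_trans (main n t t0) _; apply: lee_wpmul2r; first exact: W1_ge0.
  by rewrite lee_fin ler_expR ler_wpM2l.
exact: (squeeze_cvge bounds (cvg_cst 0%E) up).
Qed.
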